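(* Let $\mathscr{M}=(\mathsf{M},\tau,\mathfrak{m})$ and $\mathscr{M}'=(\mathsf{M}',\tau',\mathfrak{m}')$ be normalized bounded Lorentzian metric measure spaces. Then $\mathscr{M}$ and $\mathscr{M}'$ are isomorphic if and only if $\Phi(\mathscr{M})=\Phi(\mathscr{M}')$ for every polynomial $\Phi$.
   Context: A bounded Lorentzian metric space is a pair $(\mathsf{M},\tau)$ of a nonempty set $\mathsf{M}$ and a function $\tau\colon\mathsf{M}^2\to[0,\infty)$ such that: (a) $\tau(x,y)+\tau(y,z)\le\tau(x,z)$ whenever $\tau(x,y)>0$ and $\tau(y,z)>0$; (b) there is a topology $T$ on $\mathsf{M}$ such that $\tau$ is continuous for the product topology $T^2$ and $\{\tau\ge\varepsilon\}\subset\mathsf{M}^2$ is compact for every $\varepsilon>0$; (c) for all distinct $x,y\in\mathsf{M}$ there is $z\in\mathsf{M}$ with $\tau(x,z)\ne\tau(y,z)$ or $\tau(z,x)\neq\tau(z,y)$. All topological and Borel notions on $\mathsf{M}$ refer to the coarsest topology satisfying (b), which exists and is Polish. A normalized bounded Lorentzian metric measure space is a triple $\mathscr{M}=(\mathsf{M},\tau,\mathfrak{m})$ with $(\mathsf{M},\tau)$ a bounded Lorentzian metric space and $\mathfrak{m}$ a Borel probability measure on $\mathsf{M}$ (not necessarily of full support). Isomorphy. The spacelike boundary $i^0$ of a bounded Lorentzian metric space is the (unique, if it exists) point with $\tau(i^0,x)=\tau(x,i^0)=0$ for every $x$. On $\mathrm{spt}\,\mathfrak{m}$ define $x\sim y$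 if $\tau(x,z)=\tau(y,z)$ and $\tau(z,x)=\tau(z,y)$ for every $z\in\mathrm{spt}\,\mathfrak{m}$. Let $q\colon\mathrm{spt}\,\mathfrak{m}\to\tilde{\mathsf{M}}$ be the quotient projection and $\tilde\tau(q(x),q(y)):=\tau(x,y)$; then $(\tilde{\mathsf{M}},\tilde\tau)$ is a bounded Lorentzian metric space (the distance quotient), and $\mathrm{spt}\,q_\sharp\mathfrak{m}=\tilde{\mathsf{M}}$, where $\sharp$ denotes push-forward. Write $\mathrm{spt}\,q_\sharp\mathfrak{m}\cup\{i^0\}$ for this space itself if it already has a spacelike boundary, and otherwise for the bounded Lorentzian metric space obtained by adjoining an abstract point $i^0$ and extending $\tilde\tau$ by zero to pairs involving $i^0$. Use primes for the analogous objects of $\mathscr{M}'$. $\mathscr{M}$ and $\mathscr{M}'$ are isomorphic if there is a Borel measurable map $\iota\colon\mathrm{spt}\,q_\sharp\mathfrak{m}\cup\{i^0\}\to\mathrm{spt}\,q'_\sharp\mathfrak{m}'\cup\{i'^0\}$ which is distance-preserving, i.e. $\tilde\tau(x,y)=\tilde\tau'(\iota(x),\iota(y))$ for all $x,y$, and satisfies $\iota_\sharp(q_\sharp\mathfrak{m})=q'_\sharp\mathfrak{m}'$. Polynomials. For $k\in\mathbf{N}$ define $\mathsf{T}^k\colon\mathsf{M}^k\to\mathbf{R}^{k\times k}$ by $\mathsf{T}^k(x_1,\dots,x_k)_{ij}:=\tau(x_i,x_j)$. A polynomial is a function $\Phi$ on the class of normalized bounded Lorentzian metric measure spaces of the form $\Phi(\mathscr{M})=\int_{\mathsf{M}^k}\varphi\circ\mathsf{T}^k\,\mathrm{d}\mathfrak{m}^{\otimes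 k}$ for some given $k\in\mathbf{N}$ and some given bounded continuous $\varphi\colon\mathbf{R}^{k\times k}\to\mathbf{R}$. *)

(* Defs.v *)
From HB Require Import structures.
From mathcomp Require Import all_boot all_order all_algebra generic_quotient.
From mathcomp Require Import all_classical all_reals all_analysis.

Set Implicit Arguments.
Unset Strict Implicit.
Unset Printing Implicit Defensive.

Import Order.TTheory GRing.Theory Num.Theory.
Import numFieldNormedType.Exports.

Local Open Scope classical_set_scope.
Local Open Scope ring_scope.
Local Open Scope quotient_scope.

(* The set M of a bounded Lorentzian metric space comes with no distinguished
   topology, so topologies on a fixed carrier are first-class objects here. *)
Record topology (X : Type) := Topology {
  opens : set (set X) ;
  opens_setT : opens setT ;
  opens_setI : setI_closed opens ;
  opens_bigcup : forall F : set (set X),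
    F `<=` opens -> opens (\bigcup_(U in F) U) }.

(* The carrier X seen as a topologicalType whose open sets are [opens T]. *)
Definition topspace (X : choiceType) (T : topology X) : Type := X.

Section topspace.
Variables (X : choiceType) (T : topology X).

Lemma opens_bigcup_fun (I : Type) (f : I -> set X) :
  (forall i, opens T (f i)) -> opens T (\bigcup_i f i).
Proof.
move=> fo; have -> : \bigcup_i f i = \bigcup_(U in range f) U.
  by rewrite bigcup_image.
by apply: opens_bigcup => _ [i _ <-].
Qed.

HB.instance Definition _ := Choice.on (topspace T).
HB.instance Definition _ := @isOpenTopological.Build (topspace T) (opens T)
  (opens_setT T) (@opens_setI _ T) opens_bigcup_fun.

End topspace.

Section bounded_lorentzian.
Variable R : realType.

Definition admissible (X : choiceType) (tau : X -> X -> R) (T : topology X) :=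
  continuous (fun p : topspace T * topspace T => tau p.1 p.2) /\
  forall eps : R, 0 < eps ->
    compact [set p : topspace T * topspace T | eps <= tau p.1 p.2].

(* Nonemptiness of the carrier is part of pointedType. *)
Record bounded_lorentzian (X : pointedType) (tau : X -> X -> R) : Prop := {
  lor_ge0 : forall x y, 0 <= tau x y ;
  lor_reverse_triangle : forall x y z, 0 < tau x y -> 0 < tau y z ->
    tau x y + tau y z <= tau x z ;
  lor_topology : exists T : topology X, admissible tau T ;
  lor_distinguish : forall x y, x <> y ->
    exists z, tau x z <> tau y z \/ tau z x <> tau z y }.

Section coarsest.
Variables (X : choiceType) (tau : X -> X -> R).

(* The intersection of all admissible topologies: as soon as a coarsest
   admissible topology exists, it is this one. *)
Definition coarsest_opens : set (set X) :=
  [set U | forall T : topology X, admissible tau T -> opens T U].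

Lemma coarsest_setT : coarsest_opens setT.
Proof. by move=> T _; exact: opens_setT. Qed.

Lemma coarsest_setI : setI_closed coarsest_opens.
Proof. by move=> U V Uo Vo T aT; apply: opens_setI; [exact: Uo|exact: Vo]. Qed.

Lemma coarsest_bigcup (F : set (set X)) :
  F `<=` coarsest_opens -> coarsest_opens (\bigcup_(U in F) U).
Proof. by move=> Fo T aT; apply: opens_bigcup => U /Fo; exact. Qed.

Definition coarsest_topology : topology X :=
  Topology coarsest_setT coarsest_setI coarsest_bigcup.

Lemma coarsest_topologyE (T : topology X) : admissible tau T ->
  (forall T', admissible tau T' -> opens T `<=` opens T') ->
  opens T = opens coarsest_topology.
Proof.
move=> aT Tmin; apply/seteqP; split=> U; last by move=> /(_ _ aT).
by move=> TU T' aT'; exact: Tmin TU.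
Qed.

End coarsest.

End bounded_lorentzian.

Notation borel tau := (g_sigma_algebraType (opens (coarsest_topology tau))).

Record nblmms (R : realType) := Nblmms {
  carrier : pointedType ;
  tau : carrier -> carrier -> R ;
  tauP : bounded_lorentzian tau ;
  mm : probability (borel tau) R }.

Section spacelike_boundary.
Variable R : realType.

Definition is_spacelike_boundary (X : Type) (t : X -> X -> R) (i0 : X) :=
  forall x, t i0 x = 0 /\ t x i0 = 0.

(* X itself if it has a spacelike boundary, and X with the extra point None
   otherwise, both realized inside [option X]. *)
Definition add_i0_set (X : Type) (t : X -> X -> R) : set (option X) :=
  [set u | u = None -> ~ exists i0, is_spacelike_boundary t i0].

Definition add_i0 (X : Type) (t : X -> X -> R) : Type := add_i0_set t.

Section add_i0.
Variables (X : choiceType) (t : X -> X -> R).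

Definition add_i0_val : add_i0 t -> option X := sval.

Lemma add_i0_SomeP (x : X) : Some x \in add_i0_set t.
Proof. by rewrite inE. Qed.

Definition add_i0_Some (x : X) : add_i0 t := exist _ (Some x) (add_i0_SomeP x).

Definition add_i0_tau (u v : add_i0 t) : R :=
  match add_i0_val u, add_i0_val v with
  | Some x, Some y => t x y
  | _, _ => 0
  end.

Lemma add_i0_inhabited : exists u : add_i0 t, True.
Proof.
have [[x _]|no] := pselect (exists x : X, True).
  by exists (add_i0_Some x).
have NoneP : None \in add_i0_set t.
  by rewrite inE /add_i0_set /= => _ [x _]; apply: no; exists x.
by exists (exist _ None NoneP).
Qed.

HB.instance Definition _ := Choice.copy (add_i0 t) (set_type (add_i0_set t)).
HB.instance Definition _ := isPointed.Build (add_i0 t)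
  (projT1 (cid add_i0_inhabited)).

End add_i0.
End spacelike_boundary.

Section distance_quotient.
Variables (R : realType) (M : nblmms R).
Local Notation tau := (@tau R M).
Local Notation m := (@mm R M).

Definition spt : set (carrier M) :=
  [set x | forall U, opens (coarsest_topology tau) U -> U x -> (0 < m U)%E].

Definition sim (x y : spt) : bool :=
  `[< forall z : spt, tau (val x) (val z) = tau (val y) (val z) /\
                      tau (val z) (val x) = tau (val z) (val y) >].

Lemma simP x y : reflect
  (forall z : spt, tau (val x) (val z) = tau (val y) (val z) /\
                   tau (val z) (val x) = tau (val z) (val y)) (sim x y).
Proof. exact: asboolP. Qed.

Lemma sim_refl : reflexive sim.
Proof. by move=> x; apply/simP. Qed.

Lemma sim_sym : symmetric sim.
Proof.
by move=> x y; apply/simP/simP => xy z; have [? ?] := xy z; split.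
Qed.

Lemma sim_trans : transitive sim.
Proof.
move=> y x z /simP xy /simP yz; apply/simP => w.
by have [-> ->] := xy w; have [-> ->] := yz w.
Qed.

Canonical sim_equiv := EquivRel sim sim_refl sim_sym sim_trans.

Definition dquot : choiceType := {eq_quot sim}.

Definition quo_proj : spt -> dquot := \pi_({eq_quot sim}).

Definition dquot_tau (u v : dquot) : R :=
  tau (val (repr (u : {eq_quot sim}))) (val (repr (v : {eq_quot sim}))).

Lemma dquot_tauE (x y : spt) : dquot_tau (quo_proj x) (quo_proj y) = tau (val x) (val y).
Proof.
have rE z : sim (repr (quo_proj z : {eq_quot sim})) z.
  by apply/eqquotP; exact: (reprK (\pi_{eq_quot sim} z)).
have /simP/(_ (repr (quo_proj y : {eq_quot sim})))[+ _] := rE x.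
rewrite /dquot_tau => ->.
by have /simP/(_ x)[_ ->] := rE y.
Qed.

(* With q := quo_proj, the space spt(q#m), which is all of [dquot], with i0
   adjoined if necessary. *)
Definition ext : pointedType := add_i0 dquot_tau.

Definition ext_tau : ext -> ext -> R := @add_i0_tau R dquot dquot_tau.

(* q#m as a set function on the space above, carrying no mass at an adjoined i0.
   Since q is only defined on spt(m), preimages are taken in spt(m) and mapped
   back to M. *)
Definition ext_mm (A : set (borel ext_tau)) : \bar R :=
  m [set val x | x in [set x : spt | A (add_i0_Some dquot_tau (quo_proj x))]].

End distance_quotient.

Definition isomorphic (R : realType) (M M' : nblmms R) : Prop :=
  exists iota : borel (@ext_tau R M) -> borel (@ext_tau R M'),
    [/\ measurable_fun setT iota,
        forall x y, ext_tau x y = ext_tau (iota x) (iota y) &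
        forall A, measurable A -> pushforward (@ext_mm R M) iota A = ext_mm A].

Section power_measure.
Context (d : measure_display) (X : measurableType d) (R : realType).

Section step.
Variables (P : probability X R) (k : nat) (Q : probability (k.-tuple X) R).

Definition tcons (p : X * k.-tuple X) : k.+1.-tuple X := cons_tuple p.1 p.2.

Lemma measurable_tcons : measurable_fun setT tcons.
Proof.
exact: (@measurable_cons _ _ (X * k.-tuple X)%type X fst k snd).
Qed.

Definition power_step : set (k.+1.-tuple X) -> \bar R :=
  pushforward (P \x Q)%E tcons.

Let power_step0 : power_step set0 = 0%E.
Proof. by rewrite /power_step /pushforward preimage_set0 measure0. Qed.

Let power_step_ge0 A : (0 <= power_step A)%E.
Proof. by apply: (measure_ge0 (P \x Q)%E). Qed.

Let power_step_sigma_additive : semi_sigma_additive power_step.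
Proof.
move=> F mF tF mUF; rewrite /power_step /pushforward preimage_bigcup.
apply: measure_semi_sigma_additive.
- by move=> n; rewrite -[X in measurable X]setTI; exact: measurable_tcons.
- apply/trivIsetP => /= i j _ _ ij; rewrite -preimage_setI.
  by move/trivIsetP : tF => /(_ _ _ _ _ ij) ->//; rewrite preimage_set0.
- rewrite -preimage_bigcup -[X in measurable X]setTI.
  exact: measurable_tcons.
Qed.

HB.instance Definition _ := isMeasure.Build _ _ _ power_step
  power_step0 power_step_ge0 power_step_sigma_additive.

Lemma power_step_setT : power_step setT = 1%E.
Proof.
rewrite /power_step /pushforward preimage_setT -setXTT.
rewrite [LHS]product_measure1E//.
rewrite -[RHS]mule1; congr (_ * _)%E; first exact: (probability_setT P).
exact: (probability_setT Q).
Qed.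

HB.instance Definition _ := Measure_isProbability.Build _ _ _ power_step
  power_step_setT.

End step.

Fixpoint power_measure (P : probability X R) (k : nat) :
    probability (k.-tuple X) R :=
  if k is k'.+1 then power_step P (power_measure P k')
  else dirac ([tuple] : 0.-tuple X).

Lemma power_measureE (P : probability X R) (k : nat) (A : 'I_k -> set X) :
  (forall i, measurable (A i)) ->
  power_measure P k [set x | forall i, A i (tnth x i)] =
  (\prod_(i < k) P (A i))%E.
Proof.
elim: k A => [|k IH] A mA.
  by rewrite big_ord0 /= diracE mem_set//= => -[].
rewrite big_ord_recl -IH /=; last by move=> i; exact: mA.
rewrite /power_step /pushforward.
have mB : measurable [set x : k.-tuple X | forall i, A (lift ord0 i) (tnth x i)].
  rewrite [X in measurable X](_ : _ =
      \bigcap_(i in [set: 'I_k]) ((@tnth k X)^~ i @^-1` A (lift ord0 i))).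
    apply: fin_bigcap_measurable => // i _; rewrite -[X in measurable X]setTI.
    by apply: measurable_tnth => //; exact: mA.
  by apply/seteqP; split=> x /= h i; [move=> _|]; exact: h.
rewrite -product_measure1E//; congr (_ _).
apply/seteqP; split=> -[a x] /=.
  move=> h; split=> [|i]; first exact: (h ord0).
  by have := h (lift ord0 i); rewrite tnthS.
move=> [Aa h] i; case: (unliftP ord0 i) => [j ->|->]; last by [].
by rewrite tnthS; exact: h.
Qed.

End power_measure.

Section polynomials.
Variable R : realType.

Definition dist_matrix (X : Type) (t : X -> X -> R) (k : nat)
  (x : k.-tuple X) : 'M[R]_k := \matrix_(i, j) t (tnth x i) (tnth x j).

Definition is_polynomial (Phi : nblmms R -> R) : Prop :=
  exists (k : nat) (phi : 'M[R]_k -> R),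
    [/\ bounded_fun phi, continuous phi &
        forall M : nblmms R,
          Phi M = \int[power_measure (@mm R M) k]_x
                    phi (dist_matrix (@tau R M) x)].

End polynomials.

(* Main.v *)
(* The forward direction is a change of variables: both spaces map onto the
   quotient of the second one, preserving the measure and, on the supports, the
   time separation.

   For the converse, adjoining i^0 makes a bounded Lorentzian metric space
   compact for its distinction (pseudo)metric. Consider formulas built from
   truncated time separations by sums, products and integration of a variable
   against m. They are bounded and Lipschitz, and in prenex form a sentence is a
   polynomial, so sentences agree on both spaces. If finite tuples from a
   relation between the two supports satisfy the same formulas and x is in the
   support of m, then a moment argument and compactness give x' such that
   (x, x') can be added to the relation. A maximal relation is therefore a
   correspondence; it preserves the time separation, and since products of ramp
   functions of time separations are formulas, it identifies the measures on a
   pi-system generating the Borel sets. *)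

Require Import Defs.
From mathcomp Require Import all_boot all_order all_algebra generic_quotient.
From mathcomp Require Import all_classical all_reals all_analysis.
From mathcomp Require Import measurable_realfun ring lra.

Set Implicit Arguments.
Unset Strict Implicit.
Unset Printing Implicit Defensive.

Import Order.TTheory GRing.Theory Num.Theory.
Import numFieldNormedType.Exports.

Local Open Scope classical_set_scope.
Local Open Scope ring_scope.
Local Open Scope quotient_scope.

(** * The distinction metric and the coarsest topology *)

(** Single points usually have mass zero, so the points of one space cannot be matched by
    conditioning on them. A point enters instead as a parameter of a formula, and moments of [B - h]
    detect how small a nonnegative [h] gets on the support. This works for formulas because they are
    closed under products and integration: a moment of a formula is again a formula with the same
    parameters, hence covered by what the relation already preserves. Matching points need not stay
    inside the other space. A limit of approximate matches may leave every compact set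
    [{eps <= tau}], and then it tends to i^0. Relations therefore live on [option], where [None]
    stands for i^0. A relation need not be a function, as points with equal time separations may
    share partners. An arbitrary choice of partners is harmless: cylinder sets see a point only
    through its time separations, so the chosen map pulls cylinders back to cylinders. Truncation
    keeps formulas bounded; the Lipschitz property makes integrands measurable and lets values pass
    to limits of points. *)

Section distinction.
Variables (R : realType) (X : choiceType) (t : X -> X -> R).

(* The distinction metric sup_p max(|t p x - t p y|, |t x p - t y p|) is at
   most [e]. It induces the coarsest admissible topology. *)
Definition tnear (e : R) (x y : X) :=
  forall p, `|t p x - t p y| <= e /\ `|t x p - t y p| <= e.

Lemma tnear_refl e x : 0 <= e -> tnear e x x.
Proof. by move=> e0 p; rewrite !subrr normr0. Qed.

Lemma tnear_sym e x y : tnear e x y -> tnear e y x.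
Proof. by move=> xy p; have [h1 h2] := xy p; rewrite distrC h1 distrC h2. Qed.

Lemma tnear_trans e1 e2 y x z :
  tnear e1 x y -> tnear e2 y z -> tnear (e1 + e2) x z.
Proof.
move=> xy yz p; have [h1 h2] := xy p; have [h3 h4] := yz p; split.
  by rewrite (le_trans (ler_distD (t p y) _ _))// lerD.
by rewrite (le_trans (ler_distD (t y p) _ _))// lerD.
Qed.

Lemma tnear_le e1 e2 x y : e1 <= e2 -> tnear e1 x y -> tnear e2 x y.
Proof.
by move=> e12 xy p; have [h1 h2] := xy p; split; exact: le_trans e12.
Qed.

Definition dist_opens : set (set X) :=
  [set U | forall x, U x -> exists2 e, 0 < e & forall y, tnear e x y -> U y].

Lemma dist_opens_setT : dist_opens setT.
Proof. by move=> x _; exists 1. Qed.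

Lemma dist_opens_setI : setI_closed dist_opens.
Proof.
move=> U V oU oV x [Ux Vx]; have [e e0 eU] := oU x Ux.
have [d d0 dV] := oV x Vx; exists (Num.min e d) => [|y xy].
  by rewrite lt_min e0.
by split; [apply: eU|apply: dV]; apply: tnear_le xy; rewrite ge_min lexx ?orbT.
Qed.

Lemma dist_opens_bigcup (F : set (set X)) :
  F `<=` dist_opens -> dist_opens (\bigcup_(U in F) U).
Proof.
move=> oF x [U FU Ux]; have [e e0 eU] := oF U FU x Ux.
by exists e => // y /eU Uy; exists U.
Qed.

Definition dist_topology : topology X :=
  Topology dist_opens_setT dist_opens_setI dist_opens_bigcup.

Local Notation dspace := (topspace dist_topology).

Lemma nbhs_dspaceP (x : dspace) (A : set dspace) :
  nbhs x A <-> exists2 e, 0 < e & forall y, tnear e x y -> A y.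
Proof.
rewrite nbhsE; split.
  move=> [U [oU Ux] UA]; have [e e0 eU] := oU x Ux.
  by exists e => // y /eU /UA.
move=> [e e0 eA].
pose U : set dspace := [set y | exists2 d, d < e & tnear d x y].
exists U; last by move=> y [d de xy]; apply: eA; apply: tnear_le xy; exact: ltW.
split; last by exists 0 => //; exact: tnear_refl.
move=> y [d de xy]; exists ((e - d) / 2); first by lra.
move=> z yz; exists (d + (e - d) / 2); first by lra.
exact: tnear_trans xy yz.
Qed.

Lemma dist_continuous : continuous (fun p : dspace * dspace => t p.1 p.2).
Proof.
move=> [x y]; apply/cvgrPdist_le => /= e e0.
exists (tnear (e / 2) x, tnear (e / 2) y) => /=.
  by split; apply/nbhs_dspaceP; exists (e / 2) => //; lra.
move=> [x' y'] /= [xx' yy'].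
rewrite (le_trans (ler_distD (t x y') _ _))//.
by rewrite [leRHS]splitr lerD//; [have [] := yy' x | have [] := xx' y'].
Qed.

Hypothesis t_ge0 : forall x y, 0 <= t x y.

(** Compactness of [{e <= t}] gives one neighbourhood of [x] that works for every [p] with
    [e <= t p q] for some [q]. For any other [p], all values of [t p] lie in [[0, e)] and so differ
    by at most [e]. The second argument is treated in the same way. *)
Lemma admissible_nbhs (T : topology X) (x : topspace T) (e : R) :
  admissible t T -> 0 < e -> \forall y \near x, tnear e x y.
Proof.
move=> [ct kt] e0; have /compact_near_coveringP kte := kt _ e0.
have e20 : 0 < e / 2 by lra.
have h1 : \forall u \near x, forall p : topspace T * topspace T,
    e <= t p.1 p.2 -> `|t p.1 u - t p.1 x| <= e.
  apply: (kte _ (nbhs x) (fun u p => `|t p.1 u - t p.1 x| <= e) _) =>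
      -[p q] /= _.
  have /cvgrPdist_le/(_ _ e20) [[A B] /= [nA nB] AB] := ct (p, x).
  exists ([set z | A z.1], B) => /=.
    split=> //; exists (A, setT) => /=; first by split=> //; exact: filterT.
    by move=> [? ?] [].
  move=> [[p' q'] u] /= [Ap' Bu].
  have h2 := AB (p', u) (conj Ap' Bu).
  have h3 := AB (p', x) (conj Ap' (nbhs_singleton nB)).
  rewrite (le_trans (ler_distD (t p x) _ _))// [leRHS]splitr lerD//.
  by rewrite distrC.
have h2 : \forall u \near x, forall p : topspace T * topspace T,
    e <= t p.1 p.2 -> `|t u p.2 - t x p.2| <= e.
  apply: (kte _ (nbhs x) (fun u p => `|t u p.2 - t x p.2| <= e) _) =>
      -[q p] /= _.
  have /cvgrPdist_le/(_ _ e20) [[A B] /= [nA nB] AB] := ct (x, p).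
  exists ([set z | B z.2], A) => /=.
    split=> //; exists (setT, B) => /=; first by split=> //; exact: filterT.
    by move=> [? ?] [].
  move=> [[q' p'] u] /= [Bp' Au].
  have h2 := AB (u, p') (conj Au Bp').
  have h3 := AB (x, p') (conj (nbhs_singleton nA) Bp').
  rewrite (le_trans (ler_distD (t x p) _ _))// [leRHS]splitr lerD//.
  by rewrite distrC.
have small (a b : R) : 0 <= a < e -> 0 <= b < e -> `|a - b| <= e.
  by move=> ? ?; rewrite ler_norml; lra.
apply: filterS2 h1 h2 => u h1 h2 p; split.
- have [[q pq]|no] := pselect (exists q, e <= t p q).
    by rewrite distrC; exact: (h1 (p, q)).
  by apply: small; rewrite t_ge0/= ltNge; apply/negP => ?; apply: no;
    [exists x|exists u].
- have [[q pq]|no] := pselect (exists q, e <= t q p).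
    by rewrite distrC; exact: (h2 (q, p)).
  by apply: small; rewrite t_ge0/= ltNge; apply/negP => ?; apply: no;
    [exists x|exists u].
Qed.

Lemma dist_opens_coarser (T : topology X) :
  admissible t T -> dist_opens `<=` opens T.
Proof.
move=> aT U oU; suff : open (U : set (topspace T)) by [].
rewrite openE => x Ux; have [e e0 eU] := oU x Ux.
by apply: filterS (@admissible_nbhs T x e aT e0) => y /eU.
Qed.

(** The identity from [T] to the distinction topology is continuous, so it carries compact
    superlevel sets to compact ones. *)
Lemma dist_admissible (T : topology X) :
  admissible t T -> admissible t dist_topology.
Proof.
move=> aT; split; first exact: dist_continuous.
move=> e e0; have [_ /(_ _ e0) kT] := aT.
have cid2 : continuous
    (id : topspace T * topspace T -> dspace * dspace).
  move=> [x y] A [[U V] /= [/nbhs_dspaceP [d d0 dU] /nbhs_dspaceP [c c0 cV]]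
      UVA].
  exists (tnear d x, tnear c y) => /=; first by split; exact: admissible_nbhs.
  by move=> [x' y'] /= [/dU ? /cV ?]; exact: UVA.
rewrite (_ : [set p | _] = [set id p | p in
    [set p : topspace T * topspace T | e <= t p.1 p.2]]); last first.
  by rewrite image_id.
apply: continuous_compact kT; exact: continuous_subspaceT.
Qed.

Lemma coarsest_opensE (T : topology X) :
  admissible t T -> coarsest_opens t = dist_opens.
Proof.
move=> aT; apply/seteqP; split=> U.
  by move=> h; exact: (h dist_topology (dist_admissible aT)).
by move=> oU T' aT'; exact: dist_opens_coarser oU.
Qed.

End distinction.

Lemma measurable_fun_ge (d : measure_display) (T : measurableType d)
    (R : realType) (f : T -> R) :
  (forall a, measurable [set x | a <= f x]) -> measurable_fun setT f.
Proof.
move=> mf; apply: (measurability _ (RGenCInfty.measurableE R)).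
move=> _ [_ [a ->] <-]; rewrite setTI.
rewrite (_ : _ @^-1` _ = [set x | a <= f x]); first exact: mf.
by apply/seteqP; split=> x /=; rewrite in_itv/= andbT.
Qed.

Lemma measurable_fun_gt (d : measure_display) (T : measurableType d)
    (R : realType) (f : T -> R) :
  (forall a, measurable [set x | a < f x]) -> measurable_fun setT f.
Proof.
move=> mf; apply: (measurability _ (RGenOInfty.measurableE R)).
move=> _ [_ [a ->] <-]; rewrite setTI.
rewrite (_ : _ @^-1` _ = [set x | a < f x]); first exact: mf.
by apply/seteqP; split=> x /=; rewrite in_itv/= andbT.
Qed.

Lemma exists_natSinv_lt (R : realType) (e : R) : 0 < e ->
  exists k : nat, k.+1%:R^-1 < e.
Proof.
move=> e0; have [N _ /(_ N (leqnn N)) h] := near_infty_natSinv_lt (PosNum e0).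
by exists N.
Qed.

(** * Compactness after adjoining a spacelike boundary *)

Section option_space.
Variables (R : realType) (X : choiceType) (t : X -> X -> R).
Hypothesis t_ge0 : forall x y, 0 <= t x y.

(* [None] is a spacelike boundary adjoined even if [X] already has one, so the
   distinction metric on [option X] may only be a pseudometric. *)
Definition tplus (u v : option X) : R :=
  if u is Some x then if v is Some y then t x y else 0 else 0.

Lemma tplus_ge0 u v : 0 <= tplus u v.
Proof. by case: u v => [x|] [y|] /=. Qed.

Lemma tplusN u : tplus u None = 0.
Proof. by case: u. Qed.

Lemma tnear_tplus e x y : 0 <= e ->
  tnear t e x y <-> tnear tplus e (Some x) (Some y).
Proof.
move=> e0; split=> h p; last by have := h (Some p).
by case: p => [p|] /=; [exact: h|rewrite subrr normr0].
Qed.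

Local Notation ospace := (topspace (dist_topology tplus)).

Hypothesis adm : admissible t (dist_topology t).

(** A filter that does not cluster at [None] contains a set missing some [e]-ball around [None].
    Each point of that set has a time separation at least [e] to or from another point, so it lies
    in one of the two projections of the compact set [{e <= t}]. *)
Lemma compact_option : compact [set: ospace].
Proof.
move=> F FF _; have [cN|] := pselect (cluster F (None : ospace)).
  by exists None.
move=> /existsNP[A] /existsNP[B] /not_implyP[FA] /not_implyP[/nbhs_dspaceP].
move=> [e e0 eB] AB0.
have [_ /(_ _ e0) kt] := adm.
pose C : set ospace := (Some \o fst) @` [set p | e <= t p.1 p.2] `|`
                       (Some \o snd) @` [set p | e <= t p.1 p.2].
have cS (pr : X * X -> X) : pr = fst \/ pr = snd -> continuous
    (Some \o pr : topspace (dist_topology t) * topspace (dist_topology t) ->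
       ospace).
  move=> prE [x y] V /nbhs_dspaceP[d d0 dV].
  exists (tnear t d x, tnear t d y) => /=.
    by split; apply/nbhs_dspaceP; exists d.
  move=> [x' y'] /= [xx' yy']; apply: dV => /=.
  by case: prE => -> /=; apply/tnear_tplus => //; exact: ltW.
have kC : compact C.
  by apply: compactU; apply: continuous_compact kt; apply: continuous_subspaceT;
    apply: cS; [left|right].
have AC : A `<=` C.
  move=> u Au; have [uB|] := pselect (tnear tplus e None u).
    by exfalso; apply: AB0; exists u; split=> //; exact: eB.
  move=> /existsNP[[p|]]; rewrite !tplusN /= ?subr0 ?sub0r.
    case: u Au => [x|] Au; last by rewrite /= oppr0 normr0; case; split;
        exact: ltW.
    rewrite /= !normrN !ger0_norm//.
    have [h _|h1] := leP e (t p x); first by right; exists (p, x).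
    have [h _|h2] := leP e (t x p); first by left; exists (x, p).
    by case; split; exact: ltW.
  by rewrite normr0; case; rewrite ltW.
by have [u [_ ?]] := kC F FF (filterS AC FA); exists u.
Qed.

Lemma option_finite_net (e : R) : 0 < e ->
  exists s : seq (option X), forall u, exists2 v, v \in s & tnear tplus e u v.
Proof.
move=> e0; have /compact_near_coveringP kt := compact_option.
(* Finite lists directed by inclusion: near [u] every list containing [u] is good, and the covering
   property of compact sets yields a list that is good everywhere. *)
pose F : set_system (seq (option X)) :=
  filter_from setT (fun s0 : seq (option X) =>
    [set s : seq (option X) | {subset s0 <= s}]).
have FF : ProperFilter F.
  apply: filter_from_proper; last by move=> s _; exists s => x.
  apply: filter_from_filter; first by exists [::].
  move=> s1 s2 _ _; exists (s1 ++ s2) => // s /= h.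
  by split=> x xs; apply: h; rewrite mem_cat xs ?orbT.
have [u _|s _ h] := kt _ F (fun s u => exists2 v,
    v \in s & tnear tplus e u v) _.
  exists (tnear tplus e u, [set s : seq (option X) | (u :
      option X) \in s]) => /=.
    split; first by apply/nbhs_dspaceP; exists e.
    by exists [:: u] => // s; apply; rewrite inE.
  by move=> [v s] /= [uv us]; exists u => //; exact: tnear_sym.
by exists s => u; exact: (h s).
Qed.

(* The second argument of [D] enumerates a finite 1/(k+1)-net. *)
Lemma option_dense : exists D : nat -> nat -> option X,
  forall k u, exists i, tnear tplus k.+1%:R^-1 u (D k i).
Proof.
have h (k : nat) : {s : seq (option X) |
    forall u, exists2 v, v \in s & tnear tplus k.+1%:R^-1 u v}.
  by apply: cid; exact: option_finite_net.
exists (fun k i => nth None (sval (h k)) i) => k u.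
have [v vs uv] := svalP (h k) u.
by exists (index v (sval (h k))); rewrite nth_index.
Qed.

End option_space.

(** * The Borel sigma-algebra *)

Section borel.
Variables (R : realType) (X : pointedType) (t : X -> X -> R).
Hypothesis t_ge0 : forall x y, 0 <= t x y.
Hypothesis adm : admissible t (dist_topology t).

Local Notation tp := (tplus t).

Lemma opens_coarsestE : opens (coarsest_topology t) = dist_opens t.
Proof. exact: coarsest_opensE adm. Qed.

Lemma dist_opens_measurable (U : set X) : dist_opens t U ->
  measurable (U : set (borel t)).
Proof. by rewrite -opens_coarsestE => oU; exact: sub_sigma_algebra. Qed.

Lemma dist_continuous_measurable (f : X -> R) :
  (forall x e, 0 < e -> exists2 d, 0 < d &
     forall y, tnear t d x y -> `|f x - f y| <= e) ->
  measurable_fun setT (f : borel t -> R).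
Proof.
move=> cf; apply: measurable_fun_gt => a; apply: dist_opens_measurable =>
    x /= ax.
have [|d d0 h] := cf x ((f x - a) / 2); first by lra.
exists d => // y /h; rewrite ler_norml; lra.
Qed.

(** Lists make this family a pi-system, as concatenation corresponds to intersection. Lower bounds
    suffice, since they generate the Borel sets of the line. *)
Definition tcylinder (L : seq (X * R * R)) : set X :=
  [set u | forall q, q \in L -> q.1.2 <= t q.1.1 u /\ q.2 <= t u q.1.1].

Lemma setI_closed_tcylinder : setI_closed (range tcylinder).
Proof.
move=> _ _ [L1 _ <-] [L2 _ <-]; exists (L1 ++ L2) => //.
apply/seteqP; split=> u /= h; last first.
  by move=> q; rewrite mem_cat => /orP[]; [exact: h.1|exact: h.2].
by split=> q qL; apply: h; rewrite mem_cat qL ?orbT.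
Qed.

Local Notation cylType := (g_sigma_algebraType (range tcylinder)).

Let mt p : measurable_fun setT (t p : cylType -> R).
Proof.
apply: measurable_fun_ge => a; apply: sub_sigma_algebra.
(* The bound [0] on the opposite time separation is vacuous because [t] is nonnegative. *)
exists [:: (p, a, 0)] => //; apply/seteqP; split=> u /=.
  by move=> /(_ _ (mem_head _ _))[].
by move=> apu q; rewrite inE => /eqP ->.
Qed.

Let mt' p : measurable_fun setT (t ^~ p : cylType -> R).
Proof.
apply: measurable_fun_ge => a; apply: sub_sigma_algebra.
exists [:: (p, 0, a)] => //; apply/seteqP; split=> u /=.
  by move=> /(_ _ (mem_head _ _))[].
by move=> apu q; rewrite inE => /eqP ->.
Qed.

(** A ball is an uncountable intersection of conditions, one for each [p]. Moving [p] to a net point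
    at distance below [d / 2] changes the compared values by less than [d] in total, so the
    countably many net points suffice. *)
Let measurable_ball (c : option X) (e : R) :
  measurable ([set x | tnear tp e (Some x) c] : set cylType).
Proof.
have [D dD] := option_dense t_ge0 adm.
have -> : [set x | tnear tp e (Some x) c] = \bigcap_k \bigcap_i
    [set x | `|tp (D k i) (Some x) - tp (D k i) c| <= e /\
             `|tp (Some x) (D k i) - tp c (D k i)| <= e].
  apply/seteqP; split=> x /=; first by move=> h k _ i _; exact: h.
  move=> h p; split; apply/ler_addgt0Pr => d d0.
    have [k kd] : exists k : nat, k.+1%:R^-1 < d / 2.
      by apply: exists_natSinv_lt; lra.
    have [i /tnear_sym pi] := dD k p;
        have [/(_ (Some x)) [_ h1] /(_ c) [_ h2]] := (pi, pi).
    have [+ _] := h k I i I.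
    by move: (k.+1%:R^-1) kd h1 h2 => r kd; rewrite /= !ler_norml; lra.
  have [k kd] : exists k : nat, k.+1%:R^-1 < d / 2.
    by apply: exists_natSinv_lt; lra.
  have [i /tnear_sym pi] := dD k p;
      have [/(_ (Some x)) [h1 _] /(_ c) [h2 _]] := (pi, pi).
  have [_ +] := h k I i I.
  by move: (k.+1%:R^-1) kd h1 h2 => r kd; rewrite /= !ler_norml; lra.
have mle (f : cylType -> R) r : measurable_fun setT f ->
    measurable [set x | `|f x - r| <= e].
  move=> mf; rewrite -[X in measurable X]setTI.
  rewrite (_ : [set x | _] = (fun x => `|f x - r|) @^-1` `]-oo, e]%classic).
    suff : measurable_fun setT (fun x => `|f x - r|) by apply.
    by apply: measurableT_comp => //; apply: measurable_funB.
  by apply/seteqP; split=> x /=; rewrite in_itv.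
apply: bigcapT_measurable => k; apply: bigcapT_measurable => i.
apply: measurableI; apply: mle; case: (D k i) => [p|] /=.
- exact: mt.
- exact: measurable_cst.
- exact: mt'.
- exact: measurable_cst.
Qed.

(** Every open set is the countable union of the balls around net points that it contains, and these
    balls are measurable for the cylinders. *)
Lemma borel_tcylinder : @measurable _ (borel t) = <<s range tcylinder >>.
Proof.
apply/seteqP; split.
  apply: smallest_sub; first exact: smallest_sigma_algebra.
  rewrite opens_coarsestE => U oU.
  suff : measurable (U : set cylType) by [].
  have [D dD] := option_dense t_ge0 adm.
  have -> : U = \bigcup_k \bigcup_(i in [set i | forall x,
      tnear tp k.+1%:R^-1 (Some x) (D k i) -> U x])
      [set x | tnear tp k.+1%:R^-1 (Some x) (D k i)].
    apply/seteqP; split=> x; last by move=> [k _ [i h]] /h.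
    move=> Ux; have [e e0 eU] := oU x Ux.
    have [k ke] : exists k : nat, k.+1%:R^-1 < e / 2.
      by apply: exists_natSinv_lt; lra.
    have [i xi] := dD k (Some x); exists k => //; exists i => //= y yi.
    apply: eU; apply/(tnear_tplus _ _ _ (ltW e0)).
    apply: tnear_le (tnear_trans xi (tnear_sym yi)).
    by move: (k.+1%:R^-1) ke => r; lra.
  by apply: bigcupT_measurable => k; apply: bigcup_measurable => i _.
apply: smallest_sub; first exact: sigma_algebra_measurable.
move=> _ [L _ <-]; elim: L => [|q L IH].
  by rewrite (_ : tcylinder _ = setT)//; apply/seteqP; split.
rewrite (_ : tcylinder _ =
    (~` [set u | t q.1.1 u < q.1.2] `&` ~` [set u | t u q.1.1 < q.2]) `&`
    tcylinder L).
  apply: measurableI => //; apply: measurableI; apply: measurableC;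
    apply: dist_opens_measurable => x /= xq.
    exists ((q.1.2 - t q.1.1 x) / 2) => [|y /(_ q.1.1)[]]; first lra.
    by rewrite ler_norml; lra.
  exists ((q.2 - t x q.1.1) / 2) => [|y /(_ q.1.1)[_]]; first lra.
  by rewrite ler_norml; lra.
apply/seteqP; split=> u /=.
  move=> h; have [h1 h2] := h q (mem_head _ _).
  split; first by split; apply/negP; rewrite -leNgt.
  by move=> r rL; apply: h; rewrite inE rL orbT.
move=> [[/negP + /negP]]; rewrite -!leNgt => h1 h2 h r.
by rewrite inE => /orP[/eqP ->//|]; exact: h.
Qed.

Lemma measurable_tnear (c : option X) (e : R) :
  measurable ([set x | tnear tp e (Some x) c] : set (borel t)).
Proof. by rewrite borel_tcylinder; exact: measurable_ball. Qed.

Lemma measurable_tplus (u v : X -> option X) :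
  (forall x, u x = Some x) \/ (exists p, u = cst p) ->
  (forall x, v x = Some x) \/ (exists p, v = cst p) ->
  measurable_fun setT (fun x : borel t => tp (u x) (v x)).
Proof.
move=> hu hv; apply: dist_continuous_measurable => x e e0.
exists (e / 2) => [|y /tnear_tplus xy]; first by lra.
have {}xy := xy (ltW (divr_gt0 e0 (ltr0n _ 2))).
have hS (w : X -> option X) : (forall x, w x = Some x) \/ (exists p,
    w = cst p) ->
    tnear tp (e / 2) (w x) (w y).
  by move=> [wS|[p ->]]; [rewrite !wS|apply: tnear_refl; lra].
have /(_ (v x))[_ h1] := hS u hu; have /(_ (u y))[h2 _] := hS v hv.
by move: h1 h2; rewrite !ler_norml; lra.
Qed.

(** Measurability is needed for the product sigma-algebra, so [{a < t}] is written as a countable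
    union of rectangles: replacing the first point by a net point costs at most [1/(k+1)], which the
    shifted bound [a + 1/(k+1)] pays for. *)
Lemma measurable_tau : measurable_fun setT
  (fun z : borel t * borel t => t z.1 z.2).
Proof.
apply: measurable_fun_gt => a; have [D dD] := option_dense t_ge0 adm.
have -> : [set z : borel t * borel t | a < t z.1 z.2] = \bigcup_k \bigcup_i
    ([set x : borel t | tnear tp k.+1%:R^-1 (Some x) (D k i)] `*`
     [set y : borel t | a + k.+1%:R^-1 < tp (D k i) (Some y)]).
  apply/seteqP; split=> -[x y] /=.
    move=> axy; have [k ka] : exists k : nat, k.+1%:R^-1 < (t x y - a) / 2.
      by apply: exists_natSinv_lt; lra.
    have [i xi] := dD k (Some x); exists k => //; exists i => //; split=> //=.
    have [_] := xi (Some y); rewrite ler_norml /=.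
    by move: (k.+1%:R^-1) ka => r; lra.
  move=> [k _ [i _] /= [xi]].
  have [_] := xi (Some y); rewrite ler_norml /=.
  by move: (k.+1%:R^-1) => r; lra.
apply: bigcupT_measurable => k; apply: bigcupT_measurable => i.
apply: measurableX; first exact: measurable_tnear.
rewrite -[X in measurable X]setTI.
rewrite (_ : [set x | _] = (fun x => tp (D k i) (Some x)) @^-1`
    `]a + k.+1%:R^-1, +oo[%classic); last first.
  by apply/seteqP; split=> x /=; rewrite in_itv/= andbT.
suff : measurable_fun setT (fun x : borel t => tp (D k i) (Some x)) by apply.
by apply: measurable_tplus; [right; exists (D k i)|left].
Qed.

Definition ocylinder (L : seq (option X * R * R)) : set X :=
  [set x | forall q, q \in L ->
     q.1.2 <= tp q.1.1 (Some x) /\ q.2 <= tp (Some x) q.1.1].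

Lemma measurable_ocylinder L : measurable (ocylinder L : set (borel t)).
Proof.
elim: L => [|q L IH].
  by rewrite (_ : ocylinder _ = setT)//; apply/seteqP; split.
rewrite (_ : ocylinder _ =
    ((fun x => tp q.1.1 (Some x)) @^-1` `[q.1.2, +oo[%classic `&`
     (fun x => tp (Some x) q.1.1) @^-1` `[q.2, +oo[%classic) `&` ocylinder L).
  apply: measurableI => //; apply: measurableI;
    rewrite -[X in measurable X]setTI.
    suff : measurable_fun setT (fun x : borel t => tp q.1.1 (Some x)) by apply.
    by apply: measurable_tplus; [right; exists q.1.1|left].
  suff : measurable_fun setT (fun x : borel t => tp (Some x) q.1.1) by apply.
  by apply: measurable_tplus; [left|right; exists q.1.1].
apply/seteqP; split=> x /=; rewrite !in_itv/= !andbT.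
  move=> h; have [h1 h2] := h q (mem_head _ _).
  by split=> // r rL; apply: h; rewrite inE rL orbT.
by move=> [[h1 h2] h] r; rewrite inE => /orP[/eqP ->//|]; exact: h.
Qed.

End borel.

(** * Power measures *)

Section bounded_integrals.
Context (d : measure_display) (X : measurableType d) (R : realType).
Implicit Types (P : probability X R) (f g : X -> R).

Lemma bounded_integrable P f B : measurable_fun setT f ->
  (forall x, `|f x| <= B) -> P.-integrable setT (EFin \o f).
Proof.
move=> mf fB; apply: measurable_bounded_integrable => //.
  by move: (probability_setT P) => /= ->; rewrite ltry.
exists B; split; first exact: num_real.
by move=> C BC x _; apply: le_trans (fB x) (ltW BC).
Qed.

Lemma Rintegral_prob_cst P r : \int[P]_x r = r.
Proof.
by rewrite Rintegral_cst//; move: (probability_setT P) => /= ->; rewrite mulr1.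
Qed.

Lemma eq_Rintegral_full P f g (E : set X) :
  measurable_fun setT f -> measurable_fun setT g ->
  measurable E -> P (~` E) = 0%E -> (forall x, E x -> f x = g x) ->
  \int[P]_x f x = \int[P]_x g x.
Proof.
move=> mf mg mE PE fg; congr fine; apply: ae_eq_integral => //.
- exact/measurable_EFinP.
- exact/measurable_EFinP.
- exists (~` E); split=> //; first exact: measurableC.
  by move=> x /= h Ex; apply: h => _; rewrite fg.
Qed.

Lemma Rintegral_le_bound P f B : measurable_fun setT f ->
  (forall x, `|f x| <= B) -> `|\int[P]_x f x| <= B.
Proof.
move=> mf fB; have fi := bounded_integrable P mf fB.
apply: le_trans (le_normr_Rintegral _ _) _ => //.
rewrite -[leRHS](Rintegral_prob_cst P) le_Rintegral//.
- apply: (@bounded_integrable P _ B) => [|x]; last by rewrite normr_id.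
  exact: measurableT_comp.
- by apply: (@bounded_integrable P _ `|B|).
Qed.

End bounded_integrals.

Section power_integrals.
Context (d : measure_display) (X : measurableType d) (R : realType).
Variable P : probability X R.

Lemma Rintegral_power (k : nat) (G : k.+1.-tuple X -> R) B :
  measurable_fun setT G -> (forall z, `|G z| <= B) ->
  \int[power_measure P k.+1]_z G z =
  \int[P]_x \int[power_measure P k]_z G (tcons (x, z)).
Proof.
move=> mG GB; set Q := power_measure P k.
have mGt : measurable_fun setT (G \o @tcons _ X k).
  by apply: measurableT_comp => //; exact: measurable_tcons.
have iG : (P \x Q)%E.-integrable setT (EFin \o (G \o @tcons _ X k)).
  apply: measurable_bounded_integrable => //.
    rewrite -setXTT [ltLHS]product_measure1E//.
    move: (probability_setT P) (probability_setT Q) => /= -> ->.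
    by rewrite mule1 ltry.
  exists B; split; first exact: num_real.
  by move=> C BC x _; apply: le_trans (GB _) (ltW BC).
rewrite /Rintegral; congr fine.
transitivity (\int[pushforward (P \x Q) (@tcons _ X k)]_z (G z)%:E)%E.
  by [].
rewrite integral_pushforward//=; last 2 first.
- exact: measurable_tcons.
- exact/measurable_EFinP.
rewrite preimage_setT -(integral12_prod_meas1 iG).
apply: eq_integral => x _; rewrite /fubini_F /Rintegral fineK//.
apply: integrable_fin_num => //.
apply: (@bounded_integrable _ _ _ Q (fun z => G (tcons (x, z))) B) => //.
exact: (measurable_fun_pair2 x mGt).
Qed.

Lemma measurable_Rintegral_tcons (k : nat) (G : k.+1.-tuple X -> R) B :
  measurable_fun setT G -> (forall z, `|G z| <= B) ->
  measurable_fun setT (fun x => \int[power_measure P k]_z G (tcons (x, z))).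
Proof.
move=> mG GB; set Q := power_measure P k.
have mGt : measurable_fun setT (G \o @tcons _ X k).
  by apply: measurableT_comp => //; exact: measurable_tcons.
have iG : (P \x Q)%E.-integrable setT (EFin \o (G \o @tcons _ X k)).
  apply: measurable_bounded_integrable => //.
    rewrite -setXTT [ltLHS]product_measure1E//.
    move: (probability_setT P) (probability_setT Q) => /= -> ->.
    by rewrite mule1 ltry.
  exists B; split; first exact: num_real.
  by move=> C BC x _; apply: le_trans (GB _) (ltW BC).
apply: measurableT_comp; first exact: fine_measurable.
exact: (measurable_fubini_F iG).
Qed.

End power_integrals.

Section power_pushforward.
Context (d d' : measure_display) (X : measurableType d) (Y : measurableType d').
Context (R : realType) (P : probability X R) (Q : probability Y R) (f : X -> Y).
Hypothesis mf : measurable_fun setT f.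
Hypothesis PQ : forall A, measurable A -> Q A = P (f @^-1` A).

Lemma Rintegral_change (H : Y -> R) B : measurable_fun setT H ->
  (forall y, `|H y| <= B) -> \int[P]_x H (f x) = \int[Q]_y H y.
Proof.
move=> mH HB; rewrite /Rintegral; congr fine.
rewrite -[LHS](@integral_pushforward _ _ _ _ _ f mf P setT (EFin \o H))//.
- by apply: eq_measure_integral => A mA _; exact: esym (PQ mA).
- exact/measurable_EFinP.
- by apply: (@bounded_integrable _ _ _ P (H \o f) B);
    [exact: measurableT_comp|move=> x; exact: HB].
Qed.

Lemma measurable_map_tuple k : measurable_fun setT (@map_tuple k _ _ f).
Proof.
apply/measurable_fun_tnthP => i.
rewrite (_ : _ \o _ = f \o (@tnth k X)^~ i).
  by apply: measurableT_comp => //; exact: measurable_tnth.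
by apply/funext => x /=; rewrite tnth_map.
Qed.

Lemma Rintegral_power_pushforward k (G : k.-tuple Y -> R) B :
  measurable_fun setT G -> (forall z, `|G z| <= B) ->
  \int[power_measure P k]_x G (map_tuple f x) = \int[power_measure Q k]_y G y.
Proof.
elim: k G => [|k IH] G mG GB.
  transitivity (G [tuple]); [|symmetry].
    rewrite -[RHS](Rintegral_prob_cst (power_measure P 0)).
    by apply: eq_Rintegral => z _; congr G; exact: tuple0.
  rewrite -[RHS](Rintegral_prob_cst (power_measure Q 0)).
  by apply: eq_Rintegral => z _; congr G; exact: tuple0.
rewrite (@Rintegral_power _ _ _ P _ _ B)//; last first.
  by apply: measurableT_comp => //; exact: measurable_map_tuple.
rewrite (@Rintegral_power _ _ _ Q _ _ B)//.
have mGy y : measurable_fun setT (fun z => G (tcons (y, z))).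
  by apply: (@measurable_fun_pair2 _ _ _ Y (k.-tuple Y) R (G \o @tcons _ Y k));
    apply: measurableT_comp => //; exact: measurable_tcons.
rewrite -(@Rintegral_change (fun y =>
    \int[power_measure Q k]_z G (tcons (y, z))) B); last 2 first.
- exact: measurable_Rintegral_tcons mG GB.
- by move=> y; apply: Rintegral_le_bound.
apply: eq_Rintegral => x _; rewrite -IH//; apply: eq_Rintegral => z _.
by congr G; exact: val_inj.
Qed.

End power_pushforward.

Section continuous_matrix.
Context (d : measure_display) (X : measurableType d) (R : realType) (k : nat).

(* [phi] is the pointwise limit of its values at matrices with entries in
   (1/(n+1)) Z, of which there are countably many. *)
Lemma measurable_continuous_mx (phi : 'M[R]_k -> R) (a : X -> 'I_k ->
    'I_k -> R) :
  continuous phi -> (forall i j, measurable_fun setT (fun x => a x i j)) ->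
  measurable_fun setT (fun x => phi (\matrix_(i, j) a x i j)).
Proof.
move=> cphi ma.
pose F (n : nat) (x : X) : 'M[int]_k := \matrix_(i,
    j) Num.floor (n.+1%:R * a x i j).
pose D (n : nat) (B : 'M[int]_k) : 'M[R]_k := \matrix_(i,
    j) ((B i j)%:~R / n.+1%:R).
apply: (@measurable_fun_cvg _ _ _ _ (fun n x => phi (D n (F n x)))).
  move=> n _ Y mY; rewrite setTI.
  rewrite (_ : _ @^-1` _ = \bigcup_B [set x | F n x = B /\ Y (phi (D n B))]).
    apply: countable_bigcupT_measurable; first exact: countableP.
    move=> B; have [YB|nYB] := pselect (Y (phi (D n B))); last first.
      by rewrite (_ : [set x | _] = set0)//; apply/seteqP; split=> x //= [].
    rewrite (_ : [set x | _] = \bigcap_(q in [set: 'I_k * 'I_k])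
        (fun x => n.+1%:R * a x q.1 q.2) @^-1`
          `[(B q.1 q.2)%:~R, (B q.1 q.2 + 1)%:~R[%classic).
      apply: fin_bigcap_measurable => // -[i j] _ /=.
      rewrite -[X in measurable X]setTI.
      suff : measurable_fun setT (fun x => n.+1%:R * a x i j) by apply.
      exact: measurable_funM.
    apply/seteqP; split=> x /=.
      by move=> [<- _] [i j] _ /=; rewrite in_itv/= !mxE floor_itv.
    move=> h; split=> //; apply/matrixP => i j; rewrite mxE; apply: floor_def.
    by have := h (i, j) I; rewrite /= in_itv.
  by apply/seteqP; split=> x /=; [exists (F n x)|move=> [B _ [->]]].
move=> x _; apply: cvg_comp (cphi _) => V [P nP PV].
have : \forall n \near \oo, forall q : 'I_k * 'I_k,
    P q.1 q.2 (D n (F n x) q.1 q.2).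
  apply: filter_forall => -[i j] /=.
  have {}nP := nP i j; rewrite mxE in nP.
  suff : D n (F n x) i j @[n --> \oo] --> a x i j by apply.
  apply/cvgrPdist_le => e e0.
  have [N _ hN] := near_infty_natSinv_lt (PosNum e0); exists N =>
      // n /hN /= ne.
  rewrite !mxE; have n0 : 0 < n.+1%:R :> R by [].
  have := floor_itv (n.+1%:R * a x i j); rewrite intrD1.
  set z : R := (Num.floor _)%:~R => /andP[z1 z2].
  have -> : a x i j - z / n.+1%:R = (n.+1%:R * a x i j - z) / n.+1%:R.
    by field; rewrite lt0r_neq0.
  rewrite normrM ger0_norm; last by lra.
  rewrite ger0_norm ?invr_ge0//; apply: le_trans (ltW ne).
  by rewrite ler_piMl ?invr_ge0//; lra.
by apply: filterS => n h; apply: PV => i j; exact: (h (i, j)).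
Qed.

End continuous_matrix.

(** * The support and the distance quotient *)

Section support.
Variables (R : realType) (M : nblmms R).
Local Notation tau := (@tau R M).
Local Notation m := (@mm R M).
Local Notation spt := (@spt R M).

Lemma tau_ge0 x y : 0 <= tau x y.
Proof. exact: (lor_ge0 (tauP M)). Qed.

Lemma tau_admissible : admissible tau (dist_topology tau).
Proof.
have [T aT] := lor_topology (tauP M); exact: dist_admissible tau_ge0 _ aT.
Qed.

Lemma dist_opens_sptC : dist_opens tau (~` spt).
Proof.
move=> x /existsNP[U] /not_implyP[oU] /not_implyP[Ux mU].
have : dist_opens tau U by rewrite -(opens_coarsestE tau_ge0 tau_admissible).
by move=> /(_ _ Ux)[e e0 eU]; exists e => // y /eU Uy /(_ _ oU Uy).
Qed.

Lemma measurable_spt : measurable (spt : set (borel tau)).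
Proof.
rewrite -[X in measurable X]setCK; apply: measurableC.
apply: dist_opens_measurable; [exact: tau_ge0|exact: tau_admissible|].
exact: dist_opens_sptC.
Qed.

(** Each point outside the support has a null neighbourhood, hence lies in a null ball around a net
    point, and there are only countably many such balls. *)
Lemma spt_full : m (~` spt) = 0%E.
Proof.
have [D dD] := option_dense tau_ge0 tau_admissible.
pose B k i : set (borel tau) :=
  [set x | tnear (tplus tau) k.+1%:R^-1 (Some x) (D k i)].
have mB k i : measurable (B k i).
  by apply: measurable_tnear; [exact: tau_ge0|exact: tau_admissible].
pose C k i := if m (B k i) == 0%E then B k i else set0.
have mC k i : measurable (C k i) by rewrite /C; case: ifP.
have C0 k i : m (C k i) = 0%E by rewrite /C; case: ifPn => // /eqP.
have sub : (~` spt : set (borel tau)) `<=` \bigcup_k \bigcup_i C k i.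
  move=> x /existsNP[U] /not_implyP[oU] /not_implyP[Ux mU].
  have : dist_opens tau U by rewrite -(opens_coarsestE tau_ge0 tau_admissible).
  move=> /(_ _ Ux)[e e0 eU].
  have [k ke] : exists k : nat, k.+1%:R^-1 < e / 2.
    by apply: exists_natSinv_lt; lra.
  have [i xi] := dD k (Some x); exists k => //; exists i => //.
  have BU : B k i `<=` U.
    move=> y yi; apply: eU; apply/(tnear_tplus _ _ _ (ltW e0)).
    apply: tnear_le (tnear_trans xi (tnear_sym yi)).
    by move: (k.+1%:R^-1) ke => r; lra.
  rewrite /C ifT// eq_le measure_ge0 andbT leNgt; apply/negP => mBk.
  apply: mU; apply: lt_le_trans mBk _; apply: le_measure => //; rewrite inE//.
  exact: sub_sigma_algebra.
have nC : m.-negligible (\bigcup_k \bigcup_i C k i).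
  apply: negligible_bigcup => k; apply: negligible_bigcup => i.
  by exists (C k i); split; [exact: mC|exact: C0|].
have nS := negligibleS sub nC.
refine (measure_negligible _ nS).
by apply: measurableC; exact: measurable_spt.
Qed.

Lemma mm_spt : m spt = 1%E.
Proof.
rewrite -[spt]setCK probability_setC; last first.
  by apply: measurableC; exact: measurable_spt.
by rewrite spt_full sube0.
Qed.

Lemma mm_setI_spt (A : set (borel tau)) : measurable A -> m A = m (A `&` spt).
Proof.
move=> mA; rewrite [LHS](measureDI _ mA measurable_spt).
rewrite [X in (X + _)%E](_ : _ = 0%E) ?add0e//.
apply: (subset_measure0 _ _ _ spt_full) => [| |x []//].
- by apply: measurableD => //; exact: measurable_spt.
- by apply: measurableC; exact: measurable_spt.
Qed.

Definition ospt : set (option (carrier M)) :=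
  [set u | if u is Some x then spt x else True].

Lemma ext_i0_exists : {i : ext M | forall u,
    ext_tau i u = 0 /\ ext_tau u i = 0}.
Proof.
apply: cid; have [[c cP]|no] := pselect (exists c,
    is_spacelike_boundary (@dquot_tau R M) c).
  by exists (add_i0_Some _ c) => -[[v|] vP]; rewrite /ext_tau /add_i0_tau /=.
have NP : None \in add_i0_set (@dquot_tau R M) by rewrite inE.
by exists (exist _ None NP) => -[[v|] vP].
Qed.

Definition ext_i0 : ext M := sval ext_i0_exists.

(** The quotient projection made total: points off the support, a null set, get the default value
    i^0. It is not injective in general, as it identifies points related by [sim]. *)
Definition emb (u : option (carrier M)) : ext M :=
  if u is Some x then
    if pselect (spt x) is left h then
      add_i0_Some _ (quo_proj (exist _ x (mem_set h)))
    else ext_i0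
  else ext_i0.

Arguments emb : simpl never.

Definition ext_rep (w : ext M) : option (carrier M) :=
  omap (fun c : dquot M => val (repr (c :
      {eq_quot (sim (M:=M))}))) (add_i0_val w).

Lemma ext_tauE u v : ext_tau u v = tplus tau (ext_rep u) (ext_rep v).
Proof. by case: u v => [[u|] uP] [[v|] vP]. Qed.

Lemma ext_tau_ge0 (u v : ext M) : 0 <= ext_tau u v.
Proof. by rewrite ext_tauE tplus_ge0//; exact: tau_ge0. Qed.

Lemma ext_rep_ospt w : ospt (ext_rep w).
Proof. by case: w => [[c|] cP]//=; exact/set_mem/valP. Qed.

Lemma emb_Some x (h : spt x) :
  emb (Some x) = add_i0_Some _ (quo_proj (exist _ x (mem_set h))).
Proof. by rewrite /emb; case: pselect => // h';
    rewrite (Prop_irrelevance h' h). Qed.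

Lemma ext_tau_emb u v : ospt u -> ospt v ->
  ext_tau (emb u) (emb v) = tplus tau u v.
Proof.
have i0E w : ext_tau ext_i0 w = 0 /\ ext_tau w ext_i0 = 0.
  exact: (svalP ext_i0_exists).
case: u => [x|]; last by move=> _ _; rewrite (i0E _).1.
case: v => [y|]; last by move=> _ _; rewrite (i0E _).2.
move=> hx hy; rewrite (emb_Some hx) (emb_Some hy).
by rewrite /ext_tau /add_i0_tau /= dquot_tauE.
Qed.

Lemma emb_rep_Some w x : ext_rep w = Some x -> emb (Some x) = w.
Proof.
case: w => [[c|] cP]//= [<-]; set y := repr _.
have hy : spt (val y) by exact/set_mem/valP.
rewrite (emb_Some hy); apply: val_inj => /=; congr Some.
rewrite (_ : exist _ _ _ = y); last exact: val_inj.
exact: reprK.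
Qed.

(** If [ext_rep w] is [None], then [w] is the adjoined boundary and both sides vanish. Thus [w] need
    not be recovered from [None] by [emb], and uniqueness of i^0 is never invoked. *)
Lemma ext_tau_emb_rep w u : ospt u ->
  ext_tau w (emb u) = tplus tau (ext_rep w) u /\
  ext_tau (emb u) w = tplus tau u (ext_rep w).
Proof.
move=> uY; case E : (ext_rep w) => [x|].
  have hx : ospt (Some x) by rewrite -E; exact: ext_rep_ospt.
  by rewrite -(emb_rep_Some E) !ext_tau_emb.
by rewrite !ext_tauE E !tplusN; split.
Qed.

Lemma tnear_emb e x y : spt x -> spt y -> tnear tau e x y ->
  tnear (@ext_tau R M) e (emb (Some x)) (emb (Some y)).
Proof.
move=> hx hy xy w.
have [-> ->] := @ext_tau_emb_rep w (Some x) hx.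
have [-> ->] := @ext_tau_emb_rep w (Some y) hy.
case: (ext_rep w) => [z|] /=; first exact: xy.
have [h _] := xy x; rewrite subrr normr0; split; exact: le_trans h.
Qed.

(** A superlevel set at a positive level avoids i^0, so it is the image under [emb] of the
    superlevel set of [tau] cut down to the closed set of pairs in the support. Continuity of [emb]
    is available only on the support, hence the passage to the subspace topology. *)
Lemma ext_admissible : admissible (@ext_tau R M) (dist_topology (@ext_tau R M)).
Proof.
split=> [|eps eps0]; first exact: dist_continuous.
have [_ /(_ _ eps0) kt] := tau_admissible.
pose S : set (topspace (dist_topology tau) * topspace (dist_topology tau)) :=
  [set p | spt p.1 /\ spt p.2].
have cspt : closed (spt : set (topspace (dist_topology tau))).
  by rewrite -[X in closed X]setCK; apply: open_closedC; exact: dist_opens_sptC.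
have cS : closed S.
  by apply: closedI; apply: closed_comp cspt => x _;
    [exact: cvg_fst|exact: cvg_snd].
pose f (p : topspace (dist_topology tau) * topspace (dist_topology tau)) :
    topspace (dist_topology (@ext_tau R M)) *
    topspace (dist_topology (@ext_tau R M)) :=
  (emb (Some p.1), emb (Some p.2)).
have := compact_closedI kt cS; set K := _ `&` _ => kK.
rewrite (_ : [set p | _] = f @` K).
  apply: continuous_compact kK; apply/subspace_continuousP =>
      -[x y] [_ [/= hx hy]].
  move=> V [[A B] /= [/nbhs_dspaceP [a a0 aA] /nbhs_dspaceP [b b0 bB]] ABV].
  exists (tnear tau a x, tnear tau b y) => /=.
    by split; apply/nbhs_dspaceP; [exists a|exists b].
  move=> [x' y'] /= [xx' yy'] [_ [/= hx' hy']]; apply: ABV; split=> /=.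
    by apply: aA; exact: tnear_emb.
  by apply: bB; exact: tnear_emb.
apply/seteqP; split=> [[u v]|_ [[x y] [/= exy [/= hx hy]] <-]] /=; last first.
  by rewrite ext_tau_emb.
rewrite ext_tauE => euv.
case Eu : (ext_rep u) euv => [x|] /=; last by rewrite leNgt eps0.
case Ev : (ext_rep v) => [y|] /=; last by rewrite leNgt eps0.
move=> exy; exists (x, y); last first.
  by rewrite /f /= (emb_rep_Some Eu) (emb_rep_Some Ev).
split=> //; split=> /=.
  by have := ext_rep_ospt u; rewrite Eu.
by have := ext_rep_ospt v; rewrite Ev.
Qed.

Lemma preimage_emb_tcylinder L :
  spt `&` (emb \o Some) @^-1` tcylinder (@ext_tau R M) L =
  spt `&` ocylinder tau [seq (ext_rep q.1.1, q.1.2, q.2) | q <- L].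
Proof.
apply/seteqP; split=> x [hx h]; split=> //=.
  move=> _ /mapP[q qL ->]; have [h1 h2] := h q qL.
  by have [e1 e2] := @ext_tau_emb_rep q.1.1 (Some x) hx; rewrite -e1 -e2.
move=> q qL; have [-> ->] := @ext_tau_emb_rep q.1.1 (Some x) hx.
by apply: (h (ext_rep q.1.1, q.1.2, q.2)); apply/mapP; exists q.
Qed.

Lemma measurable_emb : measurable_fun setT
  (emb \o Some : borel tau -> borel (@ext_tau R M)).
Proof.
apply: (measurability _ (borel_tcylinder ext_tau_ge0 ext_admissible)).
move=> _ [_ [L _ <-] <-]; rewrite setTI.
set A := tcylinder _ L.
rewrite -(setIT (_ @^-1` A)) -(setUv spt) setIUr; apply: measurableU.
  rewrite setIC preimage_emb_tcylinder; apply: measurableI => //.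
    exact: measurable_spt.
  by apply: measurable_ocylinder; [exact: tau_ge0|exact: tau_admissible].
(* Off the support the map is constantly [ext_i0], so the remaining part of the preimage is either
   the whole complement of the support or empty. *)
have [i0A|ni0A] := pselect (A ext_i0).
  rewrite (_ : _ `&` _ = ~` spt); first by apply: measurableC; exact:
      measurable_spt.
  apply/seteqP; split=> x; first by case.
  by move=> hx; split=> //; rewrite /= /emb; case: pselect.
rewrite (_ : _ `&` _ = set0)//; apply/seteqP; split=> x//=.
by move=> [+ hx]; rewrite /emb; case: pselect.
Qed.

(** This turns [ext_mm], given by images of sets, into the push-forward under the total map [emb];
    the two differ only on the null complement of the support. *)
Lemma ext_mmE (A : set (borel (@ext_tau R M))) : measurable A ->
  ext_mm A = m ((emb \o Some) @^-1` A).
Proof.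
move=> mA.
have mpA : measurable ((emb \o Some : borel tau -> _) @^-1` A).
  by rewrite -[X in measurable X]setTI; exact: measurable_emb.
have -> : ext_mm A = m ((emb \o Some) @^-1` A `&` spt).
  congr (m _); apply/seteqP; split=> x /=.
    move=> [[y yP] /= Ay <-]; split; last exact: set_mem.
    rewrite (emb_Some (set_mem yP)).
    by rewrite (_ : exist _ _ _ = exist _ y yP)//; exact: val_inj.
  move=> [Ax hx]; rewrite (emb_Some hx) in Ax.
  by exists (exist _ x (mem_set hx)).
exact: esym (mm_setI_spt mpA).
Qed.

End support.

(** * Isomorphic spaces have equal polynomials *)

Section isomorphic_polynomials.
Variable R : realType.

Lemma measurable_dist_matrix (X : pointedType) (t : X -> X -> R)
    (t_ge0 : forall x y, 0 <= t x y)
    (adm : admissible t (dist_topology t)) k (phi : 'M[R]_k -> R) :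
  continuous phi ->
  measurable_fun setT (fun x : k.-tuple (borel t) => phi (dist_matrix t x)).
Proof.
move=> cphi; apply: measurable_continuous_mx => // i j.
apply: (@measurableT_comp _ _ _ _ _ _ (fun z : borel t * borel t => t z.1 z.2)
  _ (fun x : k.-tuple (borel t) => (tnth x i, tnth x j))).
  exact: measurable_tau.
by apply: measurable_fun_pair; exact: measurable_tnth.
Qed.

(** Applied to [emb] for the second space and to [iota] after [emb] for the first, both landing in
    the same space. Since [f] preserves time separations only on the support, the matrices are
    compared on the full-measure set [E] of tuples in the support. *)
Lemma Rintegral_dist_matrix_ext (N M : nblmms R)
    (f : borel (@tau R N) -> borel (@ext_tau R M))
    (Q : probability (borel (@ext_tau R M)) R) k (phi : 'M[R]_k -> R) B :
  measurable_fun setT f ->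
  (forall A, measurable A -> Q A = mm N (f @^-1` A)) ->
  (forall x y, @spt R N x -> @spt R N y -> tau x y = ext_tau (f x) (f y)) ->
  continuous phi -> (forall A, `|phi A| <= B) ->
  \int[power_measure (mm N) k]_x phi (dist_matrix (@tau R N) x) =
  \int[power_measure Q k]_x phi (dist_matrix (@ext_tau R M) x).
Proof.
move=> mf Qf ft cphi phiB.
have mphi :=
    measurable_dist_matrix (@ext_tau_ge0 R M) (@ext_admissible R M) cphi.
rewrite -(@Rintegral_power_pushforward _ _ _ _ _ (mm N) Q f mf Qf k _ B mphi)//.
pose E : set (k.-tuple (borel (@tau R N))) :=
  [set x | forall i, @spt R N (tnth x i)].
have mE : measurable E.
  rewrite (_ : E = \bigcap_(i in [set: 'I_k]) ((@tnth k _)^~ i @^-1` @spt R N)).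
    apply: fin_bigcap_measurable => // i _; rewrite -[X in measurable X]setTI.
    by apply: measurable_tnth => //; exact: measurable_spt.
  by apply/seteqP; split=> x /= h i; [move=> _|]; exact: h.
apply: (@eq_Rintegral_full _ _ _ _ _ _ E) => //.
- exact: (measurable_dist_matrix (@tau_ge0 R N) (@tau_admissible R N)).
- exact: (measurableT_comp mphi (measurable_map_tuple (k := k) mf)).
- rewrite probability_setC//.
  have := @power_measureE _ _ R (mm N) k (fun=> @spt R N)
    (fun=> @measurable_spt R N).
  rewrite [X in _ = X -> _]big1 => [|i _]; last exact: mm_spt.
  by move=> ->; rewrite subee.
- move=> x Ex; congr phi; apply/matrixP => i j; rewrite !mxE !tnth_map.
  exact: ft.
Qed.

Lemma bounded_fun_bound (T : Type) (f : T -> R) : bounded_fun f ->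
  exists B, forall x, `|f x| <= B.
Proof.
move=> [B [Br hB]]; exists (B + 1) => x; apply: hB => //.
by rewrite ltrDl.
Qed.

Lemma isomorphic_polynomial (M M' : nblmms R) : isomorphic M M' ->
  forall Phi : nblmms R -> R, is_polynomial Phi -> Phi M = Phi M'.
Proof.
move=> [iota [miota iotat iotam]] Phi [k [phi [phib cphi PhiE]]].
rewrite !PhiE; have [B phiB] := bounded_fun_bound phib.
have me' := @measurable_emb R M'.
pose e' : {mfun borel (@tau R M') >-> borel (@ext_tau R M')} :=
  MeasurableFun.Pack (MeasurableFun.Class (isMeasurableFun.Build _ _ _ _ _
      me')).
pose Q := distribution (mm M') e'.
rewrite (@Rintegral_dist_matrix_ext M' M' (@emb R M' \o Some) Q k phi B)//.
  apply: (@Rintegral_dist_matrix_ext M M' (iota \o (@emb R M \o Some)) Q k phi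
      B) => //.
  - by apply: measurableT_comp => //; exact: measurable_emb.
  - move=> A mA; rewrite /Q [LHS](_ : _ = ext_mm A); last by rewrite ext_mmE.
    rewrite -iotam// /pushforward ext_mmE//.
    by rewrite -[X in measurable X]setTI; exact: miota.
  - move=> x y hx hy; transitivity (ext_tau (@emb R M (Some x)) (emb (Some y))).
      exact: esym (@ext_tau_emb R M (Some x) (Some y) hx hy).
    exact: iotat.
by move=> x y hx hy; exact: esym (@ext_tau_emb R M' (Some x) (Some y) hx hy).
Qed.

End isomorphic_polynomials.

(** * Integral formulas *)

Section formulas.
Variables (R : realType) (I : Type).

(* [inl i] is a parameter, [inr n] the n-th variable in de Bruijn style, and
   [FInt] integrates out variable 0. *)
Inductive formula :=
  | FCst of R
  | FAtm of R & I + nat & I + nat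
  | FAdd of formula & formula
  | FMul of formula & formula
  | FInt of formula.

Definition param_in (S : set I) (v : I + nat) : Prop :=
  if v is inl i then S i else True.

Fixpoint params_in (S : set I) (f : formula) : Prop :=
  match f with
  | FCst _ => True
  | FAtm _ u v => param_in S u /\ param_in S v
  | FAdd f g | FMul f g => params_in S f /\ params_in S g
  | FInt f => params_in S f
  end.

Definition rename_var (s : nat -> nat) (v : I + nat) : I + nat :=
  if v is inr n then inr (s n) else v.

Definition rename_up (s : nat -> nat) (n : nat) : nat :=
  if n is n'.+1 then (s n').+1 else 0.

Fixpoint rename (s : nat -> nat) (f : formula) : formula :=
  match f with
  | FCst c => FCst c
  | FAtm c u v => FAtm c (rename_var s u) (rename_var s v)
  | FAdd f g => FAdd (rename s f) (rename s g)
  | FMul f g => FMul (rename s f) (rename s g)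
  | FInt f => FInt (rename (rename_up s) f)
  end.

(** The parameter becomes a new outermost variable: [d] is the length of the current environment,
    the value is appended at its end, and indices from [d] on shift so that they still read the
    default [None]. *)
Definition generalize_var (i : I) (d : nat) (v : I + nat) : I + nat :=
  match v with
  | inl j => if pselect (j = i) then inr d else inl j
  | inr n => inr (if (n < d)%N then n else n.+1)
  end.

Fixpoint generalize_param (i : I) (d : nat) (f : formula) : formula :=
  match f with
  | FCst c => FCst c
  | FAtm c u v => FAtm c (generalize_var i d u) (generalize_var i d v)
  | FAdd f g => FAdd (generalize_param i d f) (generalize_param i d g)
  | FMul f g => FMul (generalize_param i d f) (generalize_param i d g)
  | FInt f => FInt (generalize_param i d.+1 f)
  end.

Lemma params_in_rename S s f : params_in S (rename s f) <-> params_in S f.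
Proof.
have vE v t : param_in S (rename_var t v) <-> param_in S v by case: v.
by elim: f s => //= [c u v s|f IHf g IHg s|f IHf g IHg s];
  rewrite ?vE ?IHf ?IHg.
Qed.

Lemma params_in_generalize S i d f : params_in (S `|` [set i]) f ->
  params_in S (generalize_param i d f).
Proof.
have vE v e : param_in (S `|` [set i]) v -> param_in S (generalize_var i e v).
  by case: v => //= j [Sj|->]; case: pselect.
elim: f d => //= [c u v d [/vE ? /vE ?]//|f IHf g IHg d [? ?]
  |f IHf g IHg d [? ?]|f IHf d /IHf//];
  by split; [exact: IHf|exact: IHg].
Qed.

Lemma params_inS S S' f : S `<=` S' -> params_in S f -> params_in S' f.
Proof.
move=> SS'; have vE v : param_in S v -> param_in S' v by case: v => //= i /SS'.
elim: f => //= [c u v [/vE ? /vE ?]//|f IHf g IHg [? ?]|f IHf g IHg [? ?]];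
  by split; [exact: IHf|exact: IHg].
Qed.

Section evaluation.
Variables (N : nblmms R) (val_par : I -> option (carrier N)).
Local Notation tp := (tplus (@tau R N)).

Definition var_eval (s : seq (option (carrier N))) (v : I + nat) :=
  match v with inl i => val_par i | inr n => nth None s n end.

(** Variables beyond the environment read [None], that is i^0, so evaluation is defined for every
    formula and every list. *)
Fixpoint eval (f : formula) (s : seq (option (carrier N))) : R :=
  match f with
  | FCst c => c
  | FAtm c u v => Num.min c (tp (var_eval s u) (var_eval s v))
  | FAdd f g => eval f s + eval g s
  | FMul f g => eval f s * eval g s
  | FInt f => \int[mm N]_x eval f (Some x :: s)
  end.

Definition eval_lip (f : formula) (L : R) := forall (e : R) s s', 0 <= e ->
  (forall n, tnear tp e (nth None s n) (nth None s' n)) ->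
  `|eval f s - eval f s'| <= L * e.

Lemma eval_lip_measurable f L s : 0 <= L -> eval_lip f L ->
  measurable_fun setT (fun x : borel (@tau R N) => eval f (Some x :: s)).
Proof.
move=> L0 fL; apply: dist_continuous_measurable.
- exact: tau_ge0.
- exact: tau_admissible.
move=> x e e0; exists (e / (L + 1)); first by rewrite divr_gt0// ltr_wpDl.
have d0 : 0 <= e / (L + 1) by rewrite divr_ge0// ?addr_ge0// ltW.
move=> y /(tnear_tplus _ _ _ d0) xy.
apply: le_trans (fL _ _ _ d0 _) _.
  by case=> [|n] //=; exact: tnear_refl.
by rewrite mulrCA ler_piMr ?ltW// ltr_pdivrMr ?mul1r; lra.
Qed.

(** Both properties need a joint induction: a product is Lipschitz because its factors are bounded,
    and an integral can be bounded once its integrand is measurable, which comes from the Lipschitz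
    estimate. Atoms have constant 2, one for each argument. *)
Lemma eval_bounded_lip f : exists B : R, (forall s, `|eval f s| <= B) /\
  exists2 L : R, 0 <= L & eval_lip f L.
Proof.
elim: f => [c|c u v|f [B1 [b1 [L1 L10 l1]]] g [B2 [b2 [L2 L20 l2]]]
  |f [B1 [b1 [L1 L10 l1]]] g [B2 [b2 [L2 L20 l2]]]|f [B [b [L L0 l]]]].
- by exists `|c|; split=> //; exists 0 => // e s s' e0 _ /=;
      rewrite subrr normr0 mul0r.
- have t0 u' v' := tplus_ge0 (@tau_ge0 R N) u' v'.
  exists `|c|; split=> [s|] /=.
    have := t0 (var_eval s u) (var_eval s v).
    move: (tp _ _) => r r0; rewrite minEle; case: ifPn => // /negP/negP.
    by rewrite -ltNge => rc; rewrite !ger0_norm//; lra.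
  exists 2 => // e s s' e0 h /=.
  have hv w : tnear tp e (var_eval s w) (var_eval s' w).
    by case: w => [i|n] /=; [exact: tnear_refl|exact: h].
  have [_] := hv u (var_eval s v); have [+ _] := hv v (var_eval s' u).
  move: (tp (var_eval s u) (var_eval s v)) (tp (var_eval s' u) (var_eval s v)).
  move: (tp (var_eval s' u) (var_eval s' v)) => r1 r2 r3.
  rewrite !ler_norml /Num.min; case: (ltP c r2) => ?; case: (ltP c r1) => ?;
      lra.
- exists (B1 + B2); split=> [s|] /=.
    by rewrite (le_trans (ler_normD _ _))// lerD.
  exists (L1 + L2); first by rewrite addr_ge0.
  move=> e s s' e0 h /=; rewrite mulrDl.
  move: (l1 e s s' e0 h) (l2 e s s' e0 h); rewrite !ler_norml; lra.
- have B10 : 0 <= B1 := le_trans (normr_ge0 _) (b1 [::]).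
  have B20 : 0 <= B2 := le_trans (normr_ge0 _) (b2 [::]).
  exists (B1 * B2); split=> [s|] /=; first by rewrite normrM ler_pM.
  exists (B1 * L2 + B2 * L1); first by rewrite addr_ge0 ?mulr_ge0.
  move=> e s s' e0 h /=.
  rewrite (_ : _ - _ = eval f s * (eval g s - eval g s') +
    eval g s' * (eval f s - eval f s')); last by ring.
  rewrite (le_trans (ler_normD _ _))// !normrM mulrDl -!mulrA.
  by rewrite lerD// ler_pM//; [exact: l2|exact: l1].
- have mf s := eval_lip_measurable s L0 l.
  have intf s := bounded_integrable (mm N) (mf s) (fun x => b (Some x :: s)).
  exists B; split=> [s|] /=; first exact: Rintegral_le_bound.
  exists L => // e s s' e0 h /=; rewrite -RintegralB//.
  apply: Rintegral_le_bound => [|x]; first by apply: measurable_funB; exact: mf.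
  by apply: l => // -[|n] /=; [exact: tnear_refl|exact: h].
Qed.

Lemma eval_bounded f : exists B : R, forall s, `|eval f s| <= B.
Proof. by have [B [? _]] := eval_bounded_lip f; exists B. Qed.

Lemma measurable_eval f s :
  measurable_fun setT (fun x : borel (@tau R N) => eval f (Some x :: s)).
Proof.
by have [B [_ [L L0 fL]]] := eval_bounded_lip f; exact: eval_lip_measurable fL.
Qed.

Lemma integrable_eval f s :
  (mm N).-integrable setT (EFin \o (fun x : borel (@tau R N) =>
      eval f (Some x :: s))).
Proof.
have [B fB] := eval_bounded f.
exact: bounded_integrable (measurable_eval f s) (fun x => fB _).
Qed.

(** This is the Lipschitz estimate at distance [0]. It allows trailing [None] entries to be
    dropped. *)
Lemma eval_eq_nth f s s' : (forall n, nth None s n = nth None s' n) ->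
  eval f s = eval f s'.
Proof.
move=> ss'; have [B [_ [L L0 fL]]] := eval_bounded_lip f.
have := fL 0 s s' (lexx _); rewrite mulr0 normr_le0 subr_eq0 => /(_ _)/eqP.
by apply=> n; rewrite ss'; exact: tnear_refl.
Qed.

Lemma eval_continuous f u (e : R) : 0 < e -> exists2 d : R, 0 < d &
  forall v, tnear tp d u v -> `|eval f [:: u] - eval f [:: v]| <= e.
Proof.
move=> e0; have [B [_ [L L0 fL]]] := eval_bounded_lip f.
have d0 : 0 < e / (L + 1) by rewrite divr_gt0// ltr_wpDl.
exists (e / (L + 1)) => // v uv.
apply: le_trans (fL _ _ _ (ltW d0) _) _.
  by case=> [|n] //=; rewrite !nth_nil; apply: tnear_refl; exact: ltW.
by rewrite mulrCA ler_piMr ?ltW// ltr_pdivrMr ?mul1r; lra.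
Qed.

Lemma eval_rename f t s s' : (forall n, nth None s (t n) = nth None s' n) ->
  eval (rename t f) s = eval f s'.
Proof.
elim: f t s s' => [//|c u v|f IHf g IHg|f IHf g IHg|f IHf] t s s' h /=.
- have vE w : var_eval s (rename_var t w) = var_eval s' w by case: w => //= n.
  by rewrite !vE.
- by rewrite (IHf _ _ _ h) (IHg _ _ _ h).
- by rewrite (IHf _ _ _ h) (IHg _ _ _ h).
- by apply: eq_Rintegral => x _; apply: IHf => -[|n] /=.
Qed.

Lemma eval_generalize i f s :
  eval (generalize_param i (size s) f) (rcons s (val_par i)) = eval f s.
Proof.
elim: f s => [//|c u v|f IHf g IHg|f IHf g IHg|f IHf] s /=.
- have vE w : var_eval (rcons s (val_par i)) (generalize_var i (size s) w) =
      var_eval s w.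
    case: w => [j|n] /=; first by case: pselect => /= [ji|//];
        rewrite nth_rcons ltnn eqxx ji.
    case: ltnP => ns; first by rewrite nth_rcons ns.
    by rewrite !nth_default ?size_rcons.
  by rewrite !vE.
- by rewrite IHf IHg.
- by rewrite IHf IHg.
- by apply: eq_Rintegral => x _; rewrite -[in RHS]IHf.
Qed.

End evaluation.

(** The quantification over all spaces matters: the same prenex form has to serve for [M] and for
    [M']. *)
Definition equivalent (f g : formula) :=
  forall (N : nblmms R) (v : I -> option (carrier N)) s,
      eval v f s = eval v g s.

Definition fbin (b : bool) (f g : formula) := if b then FAdd f g else FMul f g.

(** A quantity constant in the integrated variable passes under the integral: in sums because the
    total mass is 1, in products by linearity. *)
Lemma equivalent_fbin_Intl b f g :
  equivalent (fbin b (FInt f) g) (FInt (fbin b f (rename succn g))).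
Proof.
move=> N v s; have rE x : eval v (rename succn g) (Some x :: s) = eval v g s.
  exact: eval_rename.
case: b => /=.
  under [RHS]eq_Rintegral do rewrite rE.
  rewrite RintegralD//; last exact:
      (@bounded_integrable _ _ _ _ _ `|eval v g s|).
    by rewrite Rintegral_prob_cst.
  exact: integrable_eval.
under [RHS]eq_Rintegral do rewrite rE.
by rewrite RintegralZr//; exact: integrable_eval.
Qed.

Lemma equivalent_fbin_Intr b f g :
  equivalent (fbin b g (FInt f)) (FInt (fbin b (rename succn g) f)).
Proof.
have cE h h' : equivalent (fbin b h h') (fbin b h' h).
  by move=> N v s; case: b => /=; [rewrite addrC|rewrite mulrC].
move=> N v s; rewrite cE (equivalent_fbin_Intl b f g) /=.
by apply: eq_Rintegral => x _; exact: cE.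
Qed.

Fixpoint qfree (f : formula) : bool :=
  match f with
  | FAdd f g | FMul f g => qfree f && qfree g
  | FInt _ => false
  | _ => true
  end.

Fixpoint prenex (f : formula) : bool :=
  if f is FInt f then prenex f else qfree f.

Lemma qfree_rename t f : qfree (rename t f) = qfree f.
Proof. by elim: f t => //= f IHf g IHg t; rewrite IHf IHg. Qed.

Lemma prenex_rename t f : prenex (rename t f) = prenex f.
Proof. by elim: f t => //= f IHf g IHg t; rewrite !qfree_rename. Qed.

Lemma qfree_prenex f : qfree f -> prenex f.
Proof. by case: f. Qed.

(** Integrals are pulled out of [g] while [f] is integral-free, and then out of [f]. Each extraction
    renames the other operand, so the inductions must keep it general. *)
Lemma prenex_fbin S b f g : prenex f -> prenex g -> params_in S f ->
    params_in S g ->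
  exists h, [/\ prenex h, params_in S h & equivalent (fbin b f g) h].
Proof.
have qf_qf f' g' : qfree f' -> qfree g' -> params_in S f' -> params_in S g' ->
    exists h, [/\ prenex h, params_in S h & equivalent (fbin b f' g') h].
  move=> qf qg Sf Sg; exists (fbin b f' g'); split=> //; last by case: b.
  by apply: qfree_prenex; case: b; rewrite /= qf.
have qf_case : forall f g, qfree f -> prenex g -> params_in S f ->
    params_in S g ->
    exists h, [/\ prenex h, params_in S h & equivalent (fbin b f g) h].
  move=> {}f {}g; elim: g f => [c|c u v|g1 _ g2 _|g1 _ g2 _|g IH] f qf pg Sf Sg;
    try exact: qf_qf.
  have [||h [ph Sh eh]] := IH (rename succn f) _ pg _ Sg.
  - by rewrite qfree_rename.
  - exact/params_in_rename.
  exists (FInt h); split=> // N v s; rewrite equivalent_fbin_Intr /=.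
  by apply: eq_Rintegral => x _; exact: eh.
elim: f g => [c|c u v|f1 _ f2 _|f1 _ f2 _|f IH] g pf pg Sf Sg;
  try by apply: qf_case.
have [||h [ph Sh eh]] := IH (rename succn g) pf _ Sf _.
- by rewrite prenex_rename.
- exact/params_in_rename.
exists (FInt h); split=> // N v s; rewrite equivalent_fbin_Intl /=.
by apply: eq_Rintegral => x _; exact: eh.
Qed.

Lemma prenex_form S f : params_in S f ->
  exists h, [/\ prenex h, params_in S h & equivalent f h].
Proof.
elim: f => [c|c u v|f IHf g IHg|f IHf g IHg|f IHf] Sf.
- by exists (FCst c).
- by exists (FAtm c u v).
- have [[f' [pf Sf' ef]] [g' [pg Sg' eg]]] := (IHf Sf.1, IHg Sf.2).
  have [h [ph Sh eh]] := prenex_fbin true pf pg Sf' Sg'.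
  by exists h; split=> // N v s; rewrite -eh /= ef eg.
- have [[f' [pf Sf' ef]] [g' [pg Sg' eg]]] := (IHf Sf.1, IHg Sf.2).
  have [h [ph Sh eh]] := prenex_fbin false pf pg Sf' Sg'.
  by exists h; split=> // N v s; rewrite -eh /= ef eg.
- have [h [ph Sh eh]] := IHf Sf; exists (FInt h); split=> // N v s /=.
  by apply: eq_Rintegral => x _; exact: eh.
Qed.

End formulas.

(** * Prenex sentences are polynomials *)

Section sentences.
Variables (R : realType) (I : Type).
Local Notation formula := (formula R I).

(** A polynomial needs an integrand bounded on all matrices, and [Num.min c r] is unbounded below.
    The absolute value repairs this without changing the value at time separations, which are
    nonnegative. *)
Fixpoint qf_eval (f : formula) (a : nat -> nat -> R) : R :=
  match f with
  | FCst c => c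
  | FAtm c (inr i) (inr j) => Num.min c `|a i j|
  | FAdd f g => qf_eval f a + qf_eval g a
  | FMul f g => qf_eval f a * qf_eval g a
  | _ => 0
  end.

Lemma eval_qfree (N : nblmms R) (v : I -> option (carrier N)) f s :
  qfree f -> params_in set0 f -> eval v f s =
  qf_eval f (fun i j => tplus (@tau R N) (nth None s i) (nth None s j)).
Proof.
elim: f => [//|c [i|i] [j|j] _ [] //= _ _|f IHf g IHg|f IHf g IHg|//].
- by rewrite ger0_norm// tplus_ge0//; exact: tau_ge0.
- by move=> /= /andP[qf qg] [Sf Sg]; rewrite IHf// IHg.
- by move=> /= /andP[qf qg] [Sf Sg]; rewrite IHf// IHg.
Qed.

(** The reversal reflects that variable 0 belongs to the innermost integral, hence to the last
    coordinate of the tuple. Padding by [0] matches the time separations of [None]. *)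
Definition mx_nat l (A : 'M[R]_l) (i j : nat) : R :=
  match insub i, insub j with
  | Some i, Some j => A (rev_ord i) (rev_ord j)
  | _, _ => 0
  end.

Lemma qf_eval_bounded f : exists B : R, forall a, `|qf_eval f a| <= B.
Proof.
elim: f => [c|c u v|f [B bf] g [C bg]|f [B bf] g [C bg]|f _].
- by exists `|c|.
- exists `|c| => a; case: u => [i|i] /=; first by rewrite normr0.
  case: v => [j|j] /=; first by rewrite normr0.
  move: (a i j) => r; rewrite /Num.min; case: ifPn => //; rewrite -leNgt => rc.
  by rewrite normr_id (le_trans rc)// ler_norm.
- by exists (B + C) => a /=; rewrite (le_trans (ler_normD _ _))// lerD.
- by exists (B * C) => a /=; rewrite normrM ler_pM.
- by exists 0 => a /=; rewrite normr0.
Qed.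

Lemma continuous_qf_eval l f : continuous (fun A : 'M[R]_l =>
    qf_eval f (mx_nat A)).
Proof.
elim: f => [c|c u v|f cf g cg|f cf g cg|f _] A; have FA :
    ProperFilter (nbhs A) by exact: mx_nbhs_filter.
- exact: cvg_cst.
- case: u => [i|i] /=; first exact: cvg_cst.
  case: v => [j|j] /=; first exact: cvg_cst.
  have cA : mx_nat B i j @[B --> A] --> mx_nat A i j.
    rewrite /mx_nat; case: insub => [i'|]; last exact: cvg_cst.
    case: insub => [j'|]; last exact: cvg_cst.
    exact: coord_continuous.
  (* The minimum is expressed through an absolute value, which reduces its continuity to that of the
     norm. *)
  have minE (B : 'M[R]_l) : Num.min c `|mx_nat B i j| =
      2^-1 * (c + `|mx_nat B i j| - `|c - `|mx_nat B i j| |).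
    move: (`|_|) => r; rewrite /Num.min; case: ltP => cr.
      by rewrite ler0_norm; lra.
    by rewrite ger0_norm; lra.
  rewrite /continuous_at minE; under eq_fun do rewrite minE.
  apply: cvgM; first exact: cvg_cst.
  have cN : `|mx_nat B i j| @[B --> A] --> `|mx_nat A i j|.
    exact: cvg_norm.
  apply: cvgB; first by apply: cvgD => //; exact: cvg_cst.
  by apply: cvg_norm; apply: cvgB => //; exact: cvg_cst.
- by apply: cvgD; [exact: cf|exact: cg].
- by apply: cvgM; [exact: cf|exact: cg].
- exact: cvg_cst.
Qed.

Section power.
Variables (N : nblmms R) (v : I -> option (carrier N)).
Local Notation tau := (@tau R N).

Lemma nth_catrev_tuple l (x : l.-tuple (borel tau)) s (i : nat) :
  nth None (catrev (map Some x) s) i =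
  if insub i is Some j then Some (tnth x (rev_ord (j :
      'I_l))) else nth None s (i - l).
Proof.
rewrite catrevE nth_cat size_rev size_map size_tuple.
case: insubP => [j ij jE|]; last by rewrite -leqNgt ltnNge => ->.
rewrite ij nth_rev ?size_map ?size_tuple//.
have lj : (l - i.+1 < l)%N by rewrite -jE; exact: (ltn_ord (rev_ord j)).
rewrite (nth_map point) ?size_tuple// -jE; congr Some.
by rewrite (tnth_nth point).
Qed.

Lemma measurable_qfree l f s : qfree f ->
  measurable_fun setT (fun x : l.-tuple (borel tau) =>
    eval v f (catrev (map Some x) s)).
Proof.
elim: f => [c _|c u w _|f IHf g IHg /= /andP[qf qg]|f IHf g IHg /= /andP[qf
    qg]|//].
- exact: measurable_cst.
- have varP w' : (exists p, forall x : l.-tuple (borel tau),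
      var_eval v (catrev (map Some x) s) w' = p) \/
      (exists j, forall x : l.-tuple (borel tau),
      var_eval v (catrev (map Some x) s) w' = Some (tnth x j)).
    case: w' => [i|i] /=; first by left; exists (v i).
    case E : (insub i : option 'I_l) => [j|].
      by right; exists (rev_ord j) => x; rewrite nth_catrev_tuple E.
    by left; exists (nth None s (i - l)) => x; rewrite nth_catrev_tuple E.
  rewrite /=; apply: measurable_minr; first exact: measurable_cst.
  have tg := @tau_ge0 R N; have ta := @tau_admissible R N.
  have [[p uE]|[i uE]] := varP u; have [[q wE]|[j wE]] := varP w;
    under eq_fun do rewrite uE wE.
  + exact: measurable_cst.
  + have mp : measurable_fun setT (fun y : borel tau => tplus tau p (Some y)).
      by apply: measurable_tplus => //; [right; exists p|left].
    exact: (measurableT_comp mp (measurable_tnth j)).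
  + have mq : measurable_fun setT (fun y : borel tau => tplus tau (Some y) q).
      by apply: measurable_tplus => //; [left|right; exists q].
    exact: (measurableT_comp mq (measurable_tnth i)).
  + apply: (@measurableT_comp _ _ _ _ _ _ (fun z : borel tau * borel tau =>
        tau z.1 z.2)
      _ (fun x : l.-tuple (borel tau) => (tnth x i, tnth x j))).
      exact: measurable_tau.
    by apply: measurable_fun_pair; exact: measurable_tnth.
- by apply: measurable_funD; [exact: IHf|exact: IHg].
- by apply: measurable_funM; [exact: IHf|exact: IHg].
Qed.

Lemma eval_iter_FInt l f s : qfree f -> eval v (iter l (@FInt R I) f) s =
  \int[power_measure (mm N) l]_x eval v f (catrev (map Some x) s).
Proof.
move=> qf; elim: l s => [|l IH] s.
  rewrite -[LHS](Rintegral_prob_cst (power_measure (mm N) 0)).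
  by apply: eq_Rintegral => x _; rewrite (tuple0 x).
have [B fB] := eval_bounded v f.
rewrite (@Rintegral_power _ _ _ (mm N) l
  (fun x => eval v f (catrev (map Some x) s)) B) //=; last exact:
      measurable_qfree.
by apply: eq_Rintegral => x _; rewrite IH.
Qed.

End power.

Lemma prenexP (f : formula) : prenex f ->
  exists l q, qfree q /\ f = iter l (@FInt R I) q.
Proof.
elim: f => [c|c u v|f _ g _|f _ g _|f IH] pf;
  try by eexists 0, _; split; [exact: pf|].
by have [l [q [qq ->]]] := IH pf; exists l.+1, q.
Qed.

Lemma params_in_iter S l (f : formula) :
  params_in S (iter l (@FInt R I) f) = params_in S f.
Proof. by elim: l. Qed.

(** The equality of polynomials enters the construction here. The common prenex form is an iterated
    integral, hence an integral over a power measure of a bounded continuous function of the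
    distance matrix. *)
Lemma eval_closed_eq (M M' : nblmms R) (v : I -> option (carrier M))
    (v' : I -> option (carrier M')) f :
  (forall Phi : nblmms R -> R, is_polynomial Phi -> Phi M = Phi M') ->
  params_in set0 f -> eval v f [::] = eval v' f [::].
Proof.
move=> poly Sf; have [h [/prenexP[l [q [qq ->]]] + eh]] := prenex_form Sf.
rewrite params_in_iter => Sq; rewrite !eh !eval_iter_FInt//.
pose phi (A : 'M[R]_l) := qf_eval q (mx_nat A).
have phiE (N : nblmms R) (w : I -> option (carrier N)) (x :
    l.-tuple (borel (@tau R N))) :
    eval w q (catrev (map Some x) [::]) = phi (dist_matrix (@tau R N) x).
  rewrite eval_qfree// /phi; congr qf_eval; apply/funext => i;
      apply/funext => j.
  rewrite !nth_catrev_tuple /mx_nat !nth_nil.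
  case: insubP => [i' _ _|_] //; case: insubP => [j' _ _|_] //=.
  by rewrite mxE.
under eq_Rintegral do rewrite phiE.
under [RHS]eq_Rintegral do rewrite phiE.
apply: (poly (fun N =>
    \int[power_measure (mm N) l]_x phi (dist_matrix (@tau R N) x))).
exists l, phi; split=> //; last exact: continuous_qf_eval.
have [B fB] := qf_eval_bounded q.
exists B; split; first exact: num_real.
by move=> C BC A _; apply: le_trans (fB _) (ltW BC).
Qed.

End sentences.

(** * Correspondences *)

Section extension.
Variables (R : realType) (I : Type) (M M' : nblmms R).
Variables (v : I -> option (carrier M)) (v' : I -> option (carrier M')).
Variable S : set I.
Hypothesis agree : forall f : formula R I, params_in S f ->
  eval v f [::] = eval v' f [::].

(* If [h] stayed above [e] on the support of [mm M'], the p-th moments of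
   [B - h] would grow at a strictly smaller exponential rate there than under
   [mm M], where [h] is small near [x]. *)
Lemma extension_moment (h : formula R I) (e : R) (x : carrier M) :
  params_in S h -> 0 < e -> @spt R M x ->
  (forall u, 0 <= eval v h [:: Some u]) ->
  (forall u, 0 <= eval v' h [:: Some u]) ->
  eval v h [:: Some x] = 0 ->
  exists2 y, @spt R M' y & eval v' h [:: Some y] < e.
Proof.
move=> Sh e0 hx h0 h0' hx0; apply: contrapT => no.
have {}no y : @spt R M' y -> e <= eval v' h [:: Some y].
  by move=> hy; rewrite leNgt; apply/negP => ye; apply: no; exists y.
have [B1 hB1] := eval_bounded v h; have [B2 hB2] := eval_bounded v' h.
have B10 : 0 <= B1 := le_trans (normr_ge0 _) (hB1 [::]).
have B20 : 0 <= B2 := le_trans (normr_ge0 _) (hB2 [::]).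
(* This bound makes [B - h] at least [e] in both spaces, so powers are monotone, and keeps
   [B - e / 2] positive. *)
pose B := B1 + B2 + e.
pose g := FAdd (FCst I B) (FMul (FCst I (-1)) h).
pose gp p := iter p (FMul g) (FCst I 1).
have Sgp p : params_in S (gp p) by elim: p => [//|p IH]; split.
have gpE (N : nblmms R) (w : I -> option (carrier N)) p s :
    eval w (gp p) s = (B - eval w h s) ^+ p.
  by elim: p => [//|p IH]; rewrite exprS -IH /= mulN1r.
pose U : set (borel (@tau R M)) := [set u | eval v h [:: Some u] < e / 2].
have oU : dist_opens (@tau R M) U.
  move=> u; rewrite {1}/U /= => Uu.
  have d0 : 0 < (e / 2 - eval v h [:: Some u]) / 2 by lra.
  have [d dp hd] := eval_continuous v h (Some u) d0.
  exists d => // y /(tnear_tplus _ _ _ (ltW dp)) /hd.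
  by rewrite /U /= ler_norml; lra.
have mU : measurable U.
  by apply: dist_opens_measurable oU; [exact: tau_ge0|exact: tau_admissible].
have Upos : (0 < mm M U)%E.
  apply: hx; last by rewrite /U /= hx0; lra.
  by rewrite (opens_coarsestE (@tau_ge0 R M) (@tau_admissible R M)).
have cE : mm M U = (fine (mm M U))%:E by rewrite fineK// fin_num_measure.
set c := fine _ in cE; have c0 : 0 < c by rewrite -lte_fin -cE.
have key p : c * (B - e / 2) ^+ p <= (B - e) ^+ p.
  have := agree (f := FInt (gp p)) (Sgp p); rewrite /= => eqp.
  apply: (@le_trans _ _ (\int[mm M]_u eval v (gp p) [:: Some u])).
    have -> : c * (B - e / 2) ^+ p = \int[mm M]_u ((B - e / 2) ^+ p * \1_U u).
      rewrite RintegralZl//; last first.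
        apply: (@bounded_integrable _ _ _ _ _ 1) => // u.
        by rewrite indicE; case: (_ \in _); rewrite ?normr1 ?normr0.
      by rewrite mulrC /Rintegral integral_indic// setIT.
    apply: le_Rintegral => //.
    - apply: (@bounded_integrable _ _ _ _ _ `|(B - e / 2) ^+ p|).
        by apply: measurable_funM.
      move=> u; rewrite normrM indicE; case: (_ \in _).
        by rewrite normr1 mulr1.
      by rewrite normr0 mulr0.
    - exact: integrable_eval.
    move=> u _; rewrite gpE indicE; have := hB1 [:: Some u].
    rewrite ler_norml => /andP[_ hu]; case: (boolP (u \in U)) => [|_].
      by rewrite inE /U /= => Uu; rewrite mulr1 lerXn2r// ?nnegrE /B; lra.
    by rewrite mulr0 exprn_ge0// /B; lra.
  rewrite eqp.
  have m' := measurable_eval v' (gp p) [::].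
  have [C hC] := eval_bounded v' (gp p).
  (* The bound by [(B - e) ^+ p] is known only on the support. Truncating at this value makes it
     global and changes the integrand only on a null set. *)
  rewrite (@eq_Rintegral_full _ _ _ (mm M') _
    (fun u => Num.min (eval v' (gp p) [:: Some u]) ((B - e) ^+ p)) (@spt R M')).
  - apply: le_trans (ler_norm _) _; apply: Rintegral_le_bound.
      exact: measurable_minr.
    move=> u; have h1 : 0 <= eval v' (gp p) [:: Some u].
      rewrite gpE exprn_ge0//; have := hB2 [:: Some u].
      by rewrite ler_norml /B; lra.
    have h2 : 0 <= (B - e) ^+ p by rewrite exprn_ge0// /B; lra.
    by rewrite ger0_norm ?le_min ?h1// ge_min lexx orbT.
  - by [].
  - exact: measurable_minr.
  - exact: measurable_spt.
  - exact: spt_full.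
  move=> y hy; apply/esym/min_idPl; rewrite gpE.
  have := no y hy; have := hB2 [:: Some y]; rewrite ler_norml => /andP[_ ? ?].
  by rewrite lerXn2r// ?nnegrE /B; lra.
have a0 : 0 < B - e / 2 by rewrite /B; lra.
pose z := (B - e) / (B - e / 2).
have z1 : `|z| < 1.
  rewrite ger0_norm; last by apply: divr_ge0; [rewrite /B; lra|exact: ltW].
  by rewrite ltr_pdivrMr// mul1r; lra.
have := cvg_expr z1 => /cvgrPdist_lt/(_ c c0)[n _ /(_ n (leqnn n))] /=.
rewrite sub0r normrN => zn; have := le_lt_trans (ler_norm _) zn.
rewrite /z expr_div_n ltr_pdivrMr ?exprn_gt0// => lt.
by have := le_lt_trans (key n) lt; rewrite ltxx.
Qed.

(** The sets of points of the other support where a nonnegative formula vanishing at [x] is below a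
    given threshold form a filter base, nonempty by [extension_moment]. A cluster point in the
    compact space [T] satisfies all formulas in the limit; it is [None] or, the support being
    closed, a support point. *)
Lemma extension_point (x : carrier M) : @spt R M x ->
  exists2 u, @ospt R M' u & forall f : formula R I, params_in S f ->
    eval v f [:: Some x] = eval v' f [:: u].
Proof.
move=> hx; pose T := topspace (dist_topology (tplus (@tau R M'))).
pose D : set (formula R I * R) := [set q | [/\ params_in S q.1, 0 < q.2,
  (forall u, 0 <= eval v q.1 [:: Some u]),
  (forall u, 0 <= eval v' q.1 [:: Some u]) & eval v q.1 [:: Some x] = 0]].
pose C (q : formula R I * R) : set T :=
  [set w | exists2 y, @spt R M' y & w = Some y /\ eval v' q.1 [:: w] < q.2].
pose F : set_system T := filter_from D C.
have FF : ProperFilter F.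
  apply: filter_from_proper; last first.
    move=> [h e] /= [Sh e0 h0 h0' hx0].
    have [y hy ye] := extension_moment Sh e0 hx h0 h0' hx0.
    by exists (Some y), y.
  apply: filter_from_filter; first by exists (FCst I 0, 1); split=> //=.
  move=> [h1 e1] [h2 e2] [/= S1 e10 p1 p1' x1] [/= S2 e20 p2 p2' x2].
  (* Both summands are nonnegative, so smallness of the sum forces smallness of each. *)
  exists (FAdd h1 h2, Num.min e1 e2).
    split=> //=; first by rewrite lt_min e10.
    - by move=> u; rewrite addr_ge0.
    - by move=> u; rewrite addr_ge0.
    - by rewrite x1 x2 addr0.
  move=> w [y hy [-> /=]]; rewrite lt_min => /andP[l1 l2].
  have := p1' y; have := p2' y => q2 q1.
  by split; exists y => //; split=> //=; lra.
have := compact_option (@tau_ge0 R M') (@tau_admissible R M').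
move=> /(_ F FF filterT)[w [_ clw]]; exists w.
  case: w clw => [y|//] clw; apply: contrapT => ny.
  have [e e0 ye] := @dist_opens_sptC R M' y ny.
  have FC : F (C (FCst I 0, 1)) by exists (FCst I 0, 1) => //; split.
  have nb : nbhs (Some y : T) (tnear (tplus (@tau R M')) e (Some y)).
    by apply/nbhs_dspaceP; exists e.
  have [_ [[z hz [-> _]] yz]] := clw _ _ FC nb.
  by apply: (ye z) hz; apply/(tnear_tplus _ _ _ (ltW e0)).
move=> f Sf; apply/eqP; rewrite -subr_eq0; apply/negP => /negP.
set c := eval v f [:: Some x]; rewrite -normr_gt0; set d := `|_| => d0.
(* The square of [f - c] is nonnegative and vanishes at [x]. Threshold [d ^+ 2 / 4] puts the value
   at a nearby [z] within [d / 2] of [c], and continuity adds at most [d / 4], contradicting a gap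
   of size [d] at [w]. *)
pose k := FAdd f (FCst I (- c)); pose h := FMul k k.
have Dh : D (h, d ^+ 2 / 4).
  split=> //=.
  - by rewrite divr_gt0// exprn_gt0.
  - by move=> u; rewrite -expr2 sqr_ge0.
  - by move=> u; rewrite -expr2 sqr_ge0.
  - by rewrite subrr mul0r.
have FC : F (C (h, d ^+ 2 / 4)) by exists (h, d ^+ 2 / 4).
have d40 : 0 < d / 4 by lra.
have [r r0 hr] := eval_continuous v' f w d40.
have nb : nbhs w (tnear (tplus (@tau R M')) r w).
  by apply/nbhs_dspaceP; exists r.
have [z [[y hy [zE /= lt]] /hr wz]] := clw _ _ FC nb.
have lt2 : `|eval v' f [:: z] - c| < d / 2.
  rewrite -(@ltr_pXn2r _ 2)// ?nnegrE//; last by lra.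
  by rewrite real_normK ?num_real// expr2; apply: lt_le_trans lt _; nra.
have : d <= d / 2 + d / 4.
  rewrite {1}/d -[leLHS]normrN opprB.
  by apply: le_trans (ler_distD (eval v' f [:: z]) _ _) _;
      rewrite addrC lerD// ltW.
by lra.
Qed.

End extension.

(** * Approximation of cylinder sets by formulas *)

Section ramps.
Variables (R : realType) (I : Type).

(* Evaluates to a piecewise linear approximation of the indicator of [a <= t],
   with [t] the time separation of [u] and [w]. *)
Definition framp (n : nat) (a : R) (u w : I + nat) : formula R I :=
  FMul (FCst I n.+1%:R)
    (FAdd (FAtm a u w) (FMul (FCst I (-1)) (FAtm (a - n.+1%:R^-1) u w))).

Definition fcylinder (n : nat) (L : seq (I * R * R)) : formula R I :=
  foldr (fun q f => FMul (FMul (framp n q.1.2 (inl q.1.1) (inr 0%N))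
    (framp n q.2 (inr 0%N) (inl q.1.1))) f) (FCst I 1) L.

Fixpoint list_in (S : set I) (L : seq (I * R * R)) : Prop :=
  if L is q :: L' then S q.1.1 /\ list_in S L' else True.

Lemma params_in_fcylinder S n L : list_in S L -> params_in S (fcylinder n L).
Proof. by elim: L => //= q L IH [Sq /IH]; do !split. Qed.

Section evaluation.
Variables (N : nblmms R) (v : I -> option (carrier N)).
Local Notation tau := (@tau R N).

Lemma eval_framp n a u w s : let r := eval v (framp n a u w) s in
  let t := tplus tau (var_eval v s u) (var_eval v s w) in
  [/\ 0 <= r, r <= 1, a <= t -> r = 1 & t <= a - n.+1%:R^-1 -> r = 0].
Proof.
move=> r t; rewrite /r /= -/t; have n0 : 0 < n.+1%:R :> R by [].
have i0 : 0 < n.+1%:R^-1 :> R by rewrite invr_gt0.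
have ni : n.+1%:R * n.+1%:R^-1 = 1 :> R by rewrite mulfV// lt0r_neq0.
move: (n.+1%:R) (n.+1%:R^-1) n0 i0 ni => k i k0 i0 ki.
rewrite /Num.min; case: (ltP a t) => at_; case: (ltP (a - i) t) => ait;
  split; try nra.
Qed.

Definition vcylinder (L : seq (I * R * R)) : set (carrier N) :=
  ocylinder tau [seq (v q.1.1, q.1.2, q.2) | q <- L].

Lemma eval_fcylinder_bound n L s : 0 <= eval v (fcylinder n L) s <= 1.
Proof.
elim: L => [|q L IH]; first by rewrite /= ler01 lexx.
rewrite [eval _ _ _]/=.
have := eval_framp n q.1.2 (inl q.1.1) (inr 0%N) s.
have := eval_framp n q.2 (inr 0%N) (inl q.1.1) s.
rewrite -/(framp n q.1.2 (inl q.1.1) (inr 0%N)) -/(framp n q.2 (inr 0%N) (inl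
    q.1.1)).
move=> [a0 a1 _ _] [b0 b1 _ _]; move: IH => /andP[c0 c1].
apply/andP; split; first by apply: mulr_ge0 => //; exact: mulr_ge0.
by apply: mulr_ile1 => //; [exact: mulr_ge0|exact: mulr_ile1].
Qed.

Lemma eval_fcylinder_in n L x : vcylinder L x ->
  eval v (fcylinder n L) [:: Some x] = 1.
Proof.
elim: L => [//|q L IH] h.
have [h1 h2] := h (v q.1.1, q.1.2, q.2) (mem_head _ _).
have hL : vcylinder L x by move=> r rL; apply: h; rewrite inE rL orbT.
have [_ _ /(_ h1) e1 _] := eval_framp n q.1.2 (inl q.1.1) (inr 0%N) [:: Some x].
have [_ _ /(_ h2) e2 _] := eval_framp n q.2 (inr 0%N) (inl q.1.1) [:: Some x].
transitivity (eval v (framp n q.1.2 (inl q.1.1) (inr 0%N)) [:: Some x] *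
  eval v (framp n q.2 (inr 0%N) (inl q.1.1)) [:: Some x] *
  eval v (fcylinder n L) [:: Some x]) => //.
by rewrite e1 e2 IH// !mulr1.
Qed.

(** Outside a cylinder some lower bound fails strictly, and the corresponding ramp vanishes as soon
    as its width [1/(n+1)] is below the gap. *)
Lemma eval_fcylinder_out L x : ~ vcylinder L x ->
  \forall n \near \oo, eval v (fcylinder n L) [:: Some x] = 0.
Proof.
elim: L => [|q L IH] nh; first by exfalso; apply: nh.
have prodE n : eval v (fcylinder n (q :: L)) [:: Some x] =
  eval v (framp n q.1.2 (inl q.1.1) (inr 0%N)) [:: Some x] *
  eval v (framp n q.2 (inr 0%N) (inl q.1.1)) [:: Some x] *
  eval v (fcylinder n L) [:: Some x] by [].
have [hL|/IH] := pselect (vcylinder L x); last first.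
  by apply: filterS => n e0; rewrite prodE e0 mulr0.
have small (a t : R) : t < a -> \forall n \near \oo, t <= a - n.+1%:R^-1.
  move=> ta; have d0 : 0 < a - t by lra.
  apply: filterS (near_infty_natSinv_lt (PosNum d0)) => n /=.
  by move: (n.+1%:R^-1) => r; lra.
have [h1|] := leP q.1.2 (tplus tau (v q.1.1) (Some x)); last first.
  move=> /small; apply: filterS => n lt; rewrite prodE.
  by have [_ _ _ ->] := eval_framp n q.1.2 (inl q.1.1) (inr 0%N) [:: Some x];
    rewrite ?mul0r.
have [h2|] := leP q.2 (tplus tau (Some x) (v q.1.1)); last first.
  move=> /small; apply: filterS => n lt; rewrite prodE.
  by have [_ _ _ ->] := eval_framp n q.2 (inr 0%N) (inl q.1.1) [:: Some x];
    rewrite ?mulr0 ?mul0r.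
exfalso; apply: nh => r; rewrite inE => /orP[/eqP ->//|]; exact: hL.
Qed.

Lemma cvg_fcylinder L :
  (eval v (FInt (fcylinder n L)) [::])%:E @[n --> \oo] --> mm N (vcylinder L).
Proof.
have mC : measurable (vcylinder L : set (borel tau)).
  by apply: measurable_ocylinder; [exact: tau_ge0|exact: tau_admissible].
pose f_ n (x : borel tau) := (eval v (fcylinder n L) [:: Some x])%:E.
pose f (x : borel tau) : \bar R := (\1_(vcylinder L : set (borel tau)) x)%:E.
have [] := @dominated_convergence _ _ _ (mm N) setT measurableT f_ f (cst 1%E).
- by move=> n; apply/measurable_EFinP; exact: measurable_eval.
- exact/measurable_EFinP.
- apply: aeW => x _; rewrite /f indicE; case: (boolP (x \in _)) => hx.
    apply: cvg_near_cst; near=> n; rewrite /f_ eval_fcylinder_in//.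
    exact: set_mem hx.
  apply: cvg_near_cst.
  have := @eval_fcylinder_out L x; rewrite notin_setE in hx => /(_ hx).
  by apply: filterS => n; rewrite /f_ => ->.
- apply: (@bounded_integrable _ _ _ (mm N) (cst 1) 1) => [|x].
    exact: measurable_cst.
  by rewrite normr1.
- apply: aeW => x n _; rewrite /f_ /= lee_fin.
  by have /andP[h0 h1] := eval_fcylinder_bound n L [:: Some x];
      rewrite ger0_norm.
move=> _ _; rewrite /f integral_indic// setIT.
apply: cvg_trans; apply: near_eq_cvg; near=> n.
rewrite /f_ /= /Rintegral fineK//.
apply: integrable_fin_num => //; exact: integrable_eval.
Unshelve. all: by end_near. Qed.

End evaluation.
End ramps.

(** * Maximal relations preserving all formulas *)

Section correspondence.
Variables (R : realType) (M M' : nblmms R).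
Local Notation I := (option (carrier M) * option (carrier M'))%type.

Definition agree_on (S : set I) := forall f : formula R I, params_in S f ->
  eval fst f [::] = eval snd f [::].

(** Turning the new parameter into variable 0 leaves a formula over [S] with one free variable,
    which is what [extension_point] controls. *)
Lemma agree_onU1 (S : set I) u u' :
  (forall f : formula R I, params_in S f ->
    eval fst f [:: u] = eval snd f [:: u']) ->
  agree_on (S `|` [set (u, u')]).
Proof.
move=> uu' f Sf.
rewrite -(@eval_generalize R I M fst (u, u') f [::]).
rewrite -(@eval_generalize R I M' snd (u, u') f [::]).
apply: uu'; exact: params_in_generalize.
Qed.

(** A formula has finitely many parameters, so one member of the chain contains them all. The
    alternative [set0] covers formulas without parameters even when the chain is empty. *)
Lemma params_in_chain (F : set (set I)) (f : formula R I) : total_on F subset ->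
  params_in (\bigcup_(X in F) X) f ->
  exists2 X, F X \/ X = set0 & params_in X f.
Proof.
move=> tF.
have join (P Q : set I -> Prop) : (forall X Y, X `<=` Y -> P X -> P Y) ->
    (forall X Y, X `<=` Y -> Q X -> Q Y) ->
    (exists2 X, F X \/ X = set0 & P X) -> (exists2 X, F X \/ X = set0 & Q X) ->
    exists2 X, F X \/ X = set0 & P X /\ Q X.
  move=> PS QS [X FX PX] [Y FY QY].
  have [XY|YX] : X `<=` Y \/ Y `<=` X.
    case: FX FY => [FX|->] [FY|->]; first exact: tF.
    - by right.
    - by left.
    - by left.
  - by exists Y => //; split=> //; exact: PS XY PX.
  - by exists X => //; split=> //; exact: QS YX QY.
have varP w : param_in (\bigcup_(X in F) X) w ->
    exists2 X, F X \/ X = set0 & param_in X w.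
  case: w => [i [X FX Xi]|n _]; first by exists X => //; left.
  by exists set0 => //; right.
have varS w X Y : X `<=` Y -> param_in X w -> param_in Y w.
  by move=> XY; case: w => //= i /XY.
elim: f => [c _|c u w [/varP ? /varP ?]|f IHf g IHg [/IHf ? /IHg ?]
  |f IHf g IHg [/IHf ? /IHg ?]|f IHf /IHf//].
- by exists set0 => //; right.
- by apply: join => // X Y; exact: varS.
- by apply: join => // X Y; exact: params_inS.
- by apply: join => // X Y; exact: params_inS.
Qed.

(* Take a maximal relation by Zorn's lemma: [extension_point], applied in both
   directions, shows that it is total and surjective on the supports. *)
Lemma exists_correspondence :
  (forall Phi : nblmms R -> R, is_polynomial Phi -> Phi M = Phi M') ->
  exists S : set I, [/\ agree_on S,
    (forall u, @ospt R M u -> exists2 u', @ospt R M' u' & S (u, u')) &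
    (forall u', @ospt R M' u' -> exists2 u, @ospt R M u & S (u, u'))].
Proof.
move=> poly.
pose P (S : set I) := S `<=` [set q | ospt q.1 /\ ospt q.2] /\ agree_on S.
have [S [[Sspt Sa] Smax]] : exists S, P S /\ forall B, S `<` B -> ~ P B.
  apply: Zorn_bigcup => F FP tF; split.
    by move=> q [X /FP[XS _] /XS].
  move=> f /(params_in_chain tF)[X [/FP[_ Xa]|->] Xf]; first exact: Xa.
  exact: eval_closed_eq.
have add u u' : ospt u -> ospt u' -> (forall f : formula R I, params_in S f ->
    eval fst f [:: u] = eval snd f [:: u']) -> S (u, u').
  move=> hu hu' uu'; apply: contrapT => nS.
  apply: (Smax (S `|` [set (u, u')])).
    split; first by left.
    by move=> /(_ (u, u')) h; apply: nS; apply: h; right.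
  split; last exact: agree_onU1.
  by move=> q [/Sspt//|-> /=].
(* An unassigned variable already reads [None], so assigning it [None] yields no new condition. *)
have SN : S (None, None).
  apply: add => // f Sf; have := Sa f Sf;
      by rewrite !(@eval_eq_nth _ _ _ _ f [:: None] [::])//; case=> [|[|n]].
exists S; split=> //.
- case=> [x|_]; last by exists None.
  move=> hx; have [u' hu' h] := extension_point Sa hx.
  by exists u' => //; exact: add.
- case=> [x'|_]; last by exists None.
  move=> hx'; have Sa' (f : formula R I) : params_in S f ->
      eval snd f [::] = eval fst f [::] by move=> Sf; exact: esym (Sa f Sf).
  have [u hu h] := extension_point Sa' hx'.
  by exists u => //; apply: add => // f Sf; exact: esym (h f Sf).
Qed.

Variable S : set I.
Hypothesis Sa : agree_on S.

Lemma correspondence_tplus u u' w w' : S (u, u') -> S (w, w') ->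
  tplus (@tau R M) u w = tplus (@tau R M') u' w'.
Proof.
move=> Su Sw; set t := tplus _ u w; set t' := tplus _ u' w'.
have t0 : 0 <= t by apply: tplus_ge0; exact: tau_ge0.
have t0' : 0 <= t' by apply: tplus_ge0; exact: tau_ge0.
(* The level [t + t'] is at least both nonnegative values, so this atom truncates neither. *)
have := Sa (f := FAtm (t + t') (inl (u, u')) (inl (w, w'))) (conj Su Sw).
rewrite /= -/t -/t' /Num.min.
by case: (ltP (t + t') t); case: (ltP (t + t') t'); lra.
Qed.

Lemma correspondence_cylinder L : list_in S L ->
  mm M (vcylinder fst L) = mm M' (vcylinder snd L).
Proof.
move=> SL; have c := @cvg_fcylinder R I M fst L.
have c' := @cvg_fcylinder R I M' snd L.
have E n : eval (N := M) fst (FInt (fcylinder n L)) [::] =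
    eval (N := M') snd (FInt (fcylinder n L)) [::].
  by apply: Sa; exact: params_in_fcylinder.
rewrite -(cvg_lim (@ereal_hausdorff R) c) -(cvg_lim (@ereal_hausdorff R) c').
by congr (lim (_ @ \oo)); apply/funext => n; rewrite E.
Qed.

End correspondence.

(** * Reconstruction *)

Section reconstruction.
Variables (R : realType) (M M' : nblmms R).
Local Notation I := (option (carrier M) * option (carrier M'))%type.

(** Translates cylinders of the extended space into cylinders centred at parameters, to which
    [correspondence_cylinder] applies. Both measures are first restricted to the support, where [f]
    is controlled. *)
Lemma mm_vcylinder_emb (N N' : nblmms R) (J : Type) (v : J ->
    option (carrier N))
    (f : borel (@tau R N) -> borel (@ext_tau R N'))
    (L : seq (ext N' * R * R)) (b : ext N' -> J) :
  measurable_fun setT f ->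
  (forall p x, @spt R N x ->
      ext_tau p (f x) = tplus (@tau R N) (v (b p)) (Some x) /\
    ext_tau (f x) p = tplus (@tau R N) (Some x) (v (b p))) ->
  mm N (f @^-1` tcylinder (@ext_tau R N') L) =
  mm N (vcylinder v [seq (b q.1.1, q.1.2, q.2) | q <- L]).
Proof.
move=> mf fE.
rewrite [LHS]mm_setI_spt; last first.
  rewrite -[X in measurable X]setTI; apply: mf => //.
  rewrite (borel_tcylinder (@ext_tau_ge0 R N') (@ext_admissible R N')).
  by apply: sub_sigma_algebra; exists L.
rewrite [RHS]mm_setI_spt; last first.
  by apply: measurable_ocylinder; [exact: tau_ge0|exact: tau_admissible].
rewrite /vcylinder -map_comp.
congr (mm N _); apply/seteqP; split=> x [h hx]; split=> //.
  move=> _ /mapP[q qL ->]; have [h1 h2] := h q qL.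
  by have [e1 e2] := fE q.1.1 x hx; rewrite e1 in h1; rewrite e2 in h2; split.
move=> q qL; have [e1 e2] := fE q.1.1 x hx; rewrite e1 e2.
by apply: (h (v (b q.1.1), q.1.2, q.2)); apply/mapP; exists q.
Qed.

(** Partners are chosen arbitrarily in both directions. By [iotaE], [iota w] stands to [p] as [w]
    stands to the chosen partner of [p]. Hence the preimage of a cylinder under [iota] is a cylinder
    with its centres moved by the backward choice, and [iota] is measurable whatever the choices. *)
Lemma polynomial_isomorphic :
  (forall Phi : nblmms R -> R, is_polynomial Phi -> Phi M = Phi M') ->
  isomorphic M M'.
Proof.
move=> /exists_correspondence[S [Sa S1 S2]].
have S1' (w : ext M) : {u' | ospt u' /\ S (ext_rep w, u')}.
  by apply: cid; have [u' ? ?] := S1 _ (ext_rep_ospt w); exists u'.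
have S2' (w : ext M') : {u | ospt u /\ S (u, ext_rep w)}.
  by apply: cid; have [u ? ?] := S2 _ (ext_rep_ospt w); exists u.
pose iota (w : borel (@ext_tau R M)) : borel (@ext_tau R M') :=
    emb (sval (S1' w)).
have iotaE p w :
    ext_tau p (iota w) = tplus (@tau R M) (sval (S2' p)) (ext_rep w) /\
    ext_tau (iota w) p = tplus (@tau R M) (ext_rep w) (sval (S2' p)).
  have [h1 h1'] := svalP (S1' w); have [h2 h2'] := svalP (S2' p).
  have [-> ->] := ext_tau_emb_rep p h1.
  by rewrite -(correspondence_tplus Sa h2' h1') -(correspondence_tplus Sa h1'
      h2').
have miota : measurable_fun setT iota.
  apply: (measurability _ (borel_tcylinder (@ext_tau_ge0 R M') (@ext_admissible
      R M'))).
  move=> _ [_ [L _ <-] <-]; rewrite setTI.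
  rewrite (_ : _ @^-1` _ =
      tcylinder (@ext_tau R M) [seq (emb (sval (S2' q.1.1)), q.1.2,
          q.2) | q <- L]).
    rewrite (borel_tcylinder (@ext_tau_ge0 R M) (@ext_admissible R M)).
    by apply: sub_sigma_algebra; eexists.
  have E p w : ext_tau p (iota w) = ext_tau (emb (sval (S2' p))) w /\
      ext_tau (iota w) p = ext_tau w (emb (sval (S2' p))).
    have [h2 _] := svalP (S2' p); have [-> ->] := iotaE p w.
    by have [-> ->] := ext_tau_emb_rep w h2.
  apply/seteqP; split=> w h.
    move=> _ /mapP[q qL ->]; have [h1 h2] := h q qL.
    by have [e1 e2] := E q.1.1 w; rewrite e1 in h1; rewrite e2 in h2; split.
  move=> q qL; have [-> ->] := E q.1.1 w.
  by apply: (h (emb (sval (S2' q.1.1)), q.1.2, q.2)); apply/mapP; exists q.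
have me := @measurable_emb R M; have me' := @measurable_emb R M'.
have mie := measurableT_comp miota me.
exists iota; split=> //.
  move=> x y; have [h1 h1'] := svalP (S1' x); have [h2 h2'] := svalP (S1' y).
  rewrite ext_tauE (correspondence_tplus Sa h1' h2').
  exact: esym (ext_tau_emb h1 h2).
move=> A mA; rewrite /pushforward !ext_mmE//; last first.
  by rewrite -[X in measurable X]setTI; exact: miota.
pose f : {mfun borel (@tau R M) >-> borel (@ext_tau R M')} :=
  MeasurableFun.Pack (MeasurableFun.Class (isMeasurableFun.Build _ _ _ _ _
      mie)).
pose f' : {mfun borel (@tau R M') >-> borel (@ext_tau R M')} :=
  MeasurableFun.Pack (MeasurableFun.Class (isMeasurableFun.Build _ _ _ _ _
      me')).
suff : distribution (mm M) f A = distribution (mm M') f' A by [].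
apply: (@measure_unique _ R (borel (@ext_tau R M'))
  (range (tcylinder (@ext_tau R M')))
  (fun=> tcylinder (@ext_tau R M') [::])) => //.
- exact: (borel_tcylinder (@ext_tau_ge0 R M') (@ext_admissible R M')).
- exact: setI_closed_tcylinder.
- by apply/seteqP; split=> // x _; exists 0%N.
- move=> _ [L _ <-].
  pose b (p : ext M') : I := (sval (S2' p), ext_rep p).
  transitivity (mm M (vcylinder fst [seq (b q.1.1, q.1.2, q.2) | q <- L])).
    apply: (@mm_vcylinder_emb M M' I fst (iota \o (@emb R M \o Some)) L b mie)
        => p x hx.
    have hx' : @ospt R M (Some x) by [].
    have [h2 _] := svalP (S2' p).
    have [-> ->] := iotaE p (emb (Some x)).
    rewrite -(ext_tau_emb h2 hx') -(ext_tau_emb hx' h2).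
    by have [-> ->] := ext_tau_emb_rep (emb (Some x)) h2.
  transitivity (mm M' (vcylinder snd [seq (b q.1.1, q.1.2, q.2) | q <- L])).
    apply: (correspondence_cylinder Sa).
    by elim: L => //= q L IH; split=> //; have [_] := svalP (S2' q.1.1).
  apply: esym; apply:
      (@mm_vcylinder_emb M' M' I snd (@emb R M' \o Some) L b me') => p x hx.
  exact: (@ext_tau_emb_rep R M' p (Some x) hx).
- move=> _; rewrite ltey_eq fin_num_measure//.
  rewrite (borel_tcylinder (@ext_tau_ge0 R M') (@ext_admissible R M')).
  by apply: sub_sigma_algebra; exists [::].
Qed.

End reconstruction.

Theorem theorem1p2 (R : realType) (M M' : nblmms R) :
  isomorphic M M' <->
  (forall Phi : nblmms R -> R, is_polynomial Phi -> Phi M = Phi M').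
Proof.
split; first exact: isomorphic_polynomial.
exact: polynomial_isomorphic.
Qed.
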